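(* In the stochastic contextual linear bandit setting described in the context, suppose that $\theta$ is such that the set of optimal arms $\{x_1^*,\ldots,x_M^*\}$ spans $\mathbb R^d$. Then for a suitable sequence $(\beta_t)_{t\ge1}$ with $\beta_t=O(d\log(t))$, the policy $\pi$ that plays optimistically by $$X_t=\arg\max_{x\in\mathcal A^{c_t}}\ \langle\hat\theta_{t-1},x\rangle+\|x\|_{G_{t-1}^{-1}}\,\beta_t^{1/2}$$ satisfies $$\limsup_{n\to\infty}R_\theta^\pi(n)<\infty.$$
   Context: Setting (stochastic $K$-armed contextual linear bandit). There are $M$ contexts; for each $m\in[M]=\{1,\dots,M\}$ there is a known finite action set $\mathcal A^m\subset\mathbb R^d$ with $|\mathcal A^m|=K$, such that $\mathcal A^m$ spans $\mathbb R^d$ and $\|x\|_2\le1$ for all $x\in\bigcup_m\mathcal A^m$. The parameter $\theta\in\mathbb R^d$ is fixed and unknown. Contexts $c_1,c_2,\dots$ are drawn i.i.d. from an unknown distribution $p$ on $[M]$ with $p(m)>0$ for all $m$. In round $t$ the learner sees $c_t$, chooses $X_t\in\mathcal A^{c_t}$ and receives $Y_t=\langle X_t,\theta\rangle+\eta_t$, with $\eta_t$ independent standard Gaussians. For each $m$, $x_m^*=\arg\max_{x\in\mathcal A^m}\langle x,\theta\rangle$ is the optimal arm, assumed unique. The regret is $R_\theta^\pi(n)=\mathbb E\big[\sum_{t=1}^n\langle x_{c_t}^*,\theta\rangle-\sum_{t=1}^nY_t\big]$. Notation: $G_t=\sum_{s=1}^tX_sX_s^\top$, $\hat\theta_t=G_t^{-1}\sum_{s=1}^tX_sY_s$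 (least squares), $\|x\|_A=\sqrt{x^\top Ax}$. During the first $d$ rounds the policy plays any $X_t\in\mathcal A^{c_t}$ not in the span of $\{X_1,\dots,X_{t-1}\}$, so that $G_t$ is invertible for $t\ge d$; the optimistic rule is used for $t>d$. *)

(* Defs.v *)
From HB Require Import structures.
From mathcomp Require Import all_boot all_order all_algebra finmap.
From mathcomp Require Import all_classical all_reals all_analysis.

Set Implicit Arguments.
Unset Strict Implicit.
Unset Printing Implicit Defensive.

Import Order.TTheory GRing.Theory Num.Theory.
Import numFieldNormedType.Exports.

Local Open Scope classical_set_scope.
Local Open Scope ring_scope.

(* Rounds are numbered from 1; the values at index 0 of the
   sequences c, X, eta (and of beta) are never used. *)

Section Euclidean.
Context {R : realType} {d : nat}.

Definition dotv (x y : 'cV[R]_d) : R := (x^T *m y) 0 0.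

(* The Euclidean norm; the library's `|x| on matrices is the sup norm. *)
Definition norm2 (x : 'cV[R]_d) : R := Num.sqrt (dotv x x).

Definition wnorm (A : 'M[R]_d) (x : 'cV[R]_d) : R :=
  Num.sqrt (dotv x (A *m x)).

Definition spanning (vs : seq 'cV[R]_d) : Prop := <<vs>>%VS = fullv.

End Euclidean.

Definition action_sets (R : realType) (d M K : nat)
    (A : 'I_M -> {fset 'cV[R]_d}) : Prop :=
  forall m, [/\ #|` A m | = K,
                spanning (enum_fset (A m)) &
                forall x, x \in A m -> norm2 x <= 1].

Definition unique_optimal (R : realType) (d M : nat)
    (A : 'I_M -> {fset 'cV[R]_d}) (theta : 'cV[R]_d)
    (xstar : 'I_M -> 'cV[R]_d) : Prop :=
  forall m, xstar m \in A m /\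
    forall x, x \in A m -> x != xstar m -> dotv x theta < dotv (xstar m) theta.

Section Probability.
Context {R : realType} {disp : measure_display} {T : measurableType disp}.
Variable P : probability T R.

Definition independent_systems (F G : set (set T)) : Prop :=
  forall A B, F A -> G B -> P (A `&` B) = (P A * P B)%E.

(* Generates sigma(f) when f takes finitely many values. *)
Definition fibers {V : Type} (f : T -> V) : set (set T) :=
  [set E | exists v, E = f @^-1` [set v]].

Definition events_of (f : T -> R) : set (set T) :=
  preimage_set_system setT f measurable.

End Probability.

Section Bandit.
Context {R : realType} {d M : nat}.
Context {disp : measure_display} {T : measurableType disp}.
Variable P : probability T R.
Variables (A : 'I_M -> {fset 'cV[R]_d}) (theta : 'cV[R]_d).
Variable p : 'I_M -> R.
Variables (c : nat -> T -> 'I_M) (X : nat -> T -> 'cV[R]_d).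
Variable eta : nat -> {RV P >-> R}.

Definition past (t : nat) : set (set T) :=
  \bigcup_(s in [set s | (0 < s < t)%N])
    (fibers (c s) `|` fibers (X s) `|` events_of (eta s)).

(* The learner may randomize, but X_t cannot anticipate the noise of round t
   nor the later rounds: each context is fresh given the past, and each noise
   is fresh given the past together with (c_t, X_t). In particular the contexts
   are i.i.d. with law p and the noises are independent standard Gaussians. *)
Record interaction : Prop := {
  context_measurable : forall t m, (0 < t)%N -> measurable (c t @^-1` [set m]);
  action_measurable : forall t x, (0 < t)%N -> measurable (X t @^-1` [set x]);
  action_available : forall t w, (0 < t)%N -> X t w \in A (c t w);
  context_law : forall t m, (0 < t)%N -> P (c t @^-1` [set m]) = (p m)%:E;
  context_fresh : forall t, (0 < t)%N ->
    independent_systems P <<s past t >> <<s fibers (c t) >>;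
  noise_law : forall t (B : set R), (0 < t)%N -> measurable B ->
    distribution P (eta t) B = normal_prob 0 1 B;
  noise_fresh : forall t, (0 < t)%N ->
    independent_systems P
      <<s past t `|` fibers (c t) `|` fibers (X t) >> <<s events_of (eta t) >>
}.

Definition reward (t : nat) (w : T) : R := dotv (X t w) theta + eta t w.

Definition gram (t : nat) (w : T) : 'M[R]_d :=
  \sum_(1 <= s < t.+1) X s w *m (X s w)^T.

Definition lse (t : nat) (w : T) : 'cV[R]_d :=
  invmx (gram t w) *m \sum_(1 <= s < t.+1) reward s w *: X s w.

Definition ucb (beta : nat -> R) (t : nat) (w : T) (x : 'cV[R]_d) : R :=
  dotv (lse t.-1 w) x + wnorm (invmx (gram t.-1 w)) x * Num.sqrt (beta t).

(* Ties in the argmax, and the choice in the first d rounds, are arbitrary. *)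
Definition optimistic (beta : nat -> R) : Prop :=
  (forall t w, (0 < t <= d)%N ->
     X t w \notin <<[seq X s w | s <- iota 1 t.-1]>>%VS) /\
  (forall t w, (d < t)%N -> forall x, x \in A (c t w) ->
     ucb beta t w x <= ucb beta t w (X t w)).

Definition regret (xstar : 'I_M -> 'cV[R]_d) (n : nat) : \bar R :=
  'E_P[fun w => \sum_(1 <= t < n.+1) dotv (xstar (c t w)) theta -
                \sum_(1 <= t < n.+1) reward t w].

End Bandit.

(* Main.v *)
Require Import Defs.
From HB Require Import structures.
From mathcomp Require Import all_boot all_order all_algebra finmap.
From mathcomp Require Import all_classical all_reals all_analysis.
From mathcomp Require Import measurable_realfun.
From mathcomp Require Import ring lra zify.

(* For a fixed vector u, exp(<u, S_t> - <u, G_t u> / 2), with S_t the sum of the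
   eta_s X_s, has mean 1. Summing over the u in a grid of mesh 1/t in [-t^2, t^2]^d,
   Markov's inequality bounds all the exponents by O(d log t) with probability
   1 - t^-3. The grid point closest to G_t^-1 S_t then bounds
   <G_t^-1 S_t, S_t> = ||theta_hat - theta||^2_{G_t} by beta_{t+1}. No regularisation
   is needed: the first d actions take finitely many values, so G_t >= I / a with a
   constant a that only enters the time from which the bound holds.

   When the confidence bounds hold throughout the window (t/2, t], an arm x is played
   while suboptimal only O(log t) times there, because ||x||^2_{G^-1} is at most the
   inverse of its number of plays. Every context occurs linearly often in the window,
   so every optimal arm has been played more than a large multiple of log t times;
   as the optimal arms span the space, every arm has a width too small for a
   suboptimal arm to be played in round t + 1. The exceptional probabilities are
   O(t^-2), hence summable. Both failure events are controlled by a single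
   nonnegative random variable ("score") that is at least 1 whenever the arm played in
   round t + 1 is suboptimal, so that only its expectation has to be computed. *)

Set Implicit Arguments.
Unset Strict Implicit.
Unset Printing Implicit Defensive.

Import Order.TTheory GRing.Theory Num.Theory.
Import numFieldNormedType.Exports.

Local Open Scope classical_set_scope.
Local Open Scope ring_scope.

(** * Quadratic forms *)

Section DotProduct.
Context {R : realType} {d : nat}.
Implicit Types (x y z : 'cV[R]_d) (G : 'M[R]_d).

Lemma dotvE x y : dotv x y = \sum_i x i 0 * y i 0.
Proof. by rewrite /dotv mxE; apply: eq_bigr => i _; rewrite mxE. Qed.

Lemma dotvC x y : dotv x y = dotv y x.
Proof. by rewrite !dotvE; apply: eq_bigr => i _; rewrite mulrC. Qed.

Lemma dotvDr x y z : dotv x (y + z) = dotv x y + dotv x z.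
Proof. by rewrite /dotv mulmxDr mxE. Qed.

Lemma dotvZr (a : R) x y : dotv x (a *: y) = a * dotv x y.
Proof. by rewrite /dotv -scalemxAr mxE. Qed.

Lemma dotvNr x y : dotv x (- y) = - dotv x y.
Proof. by rewrite -scaleN1r dotvZr mulN1r. Qed.

Lemma dotvBr x y z : dotv x (y - z) = dotv x y - dotv x z.
Proof. by rewrite dotvDr dotvNr. Qed.

Lemma dotvDl x y z : dotv (x + y) z = dotv x z + dotv y z.
Proof. by rewrite dotvC dotvDr !(dotvC z). Qed.

Lemma dotvZl (a : R) x y : dotv (a *: x) y = a * dotv x y.
Proof. by rewrite dotvC dotvZr dotvC. Qed.

Lemma dotvBl x y z : dotv (x - y) z = dotv x z - dotv y z.
Proof. by rewrite dotvC dotvBr !(dotvC z). Qed.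

Lemma dotv0r x : dotv x 0 = 0.
Proof. by rewrite /dotv mulmx0 mxE. Qed.

Lemma dotv_sumr (I : Type) (r : seq I) (P : pred I) (F : I -> 'cV[R]_d) x :
  dotv x (\sum_(i <- r | P i) F i) = \sum_(i <- r | P i) dotv x (F i).
Proof. by rewrite /dotv mulmx_sumr summxE. Qed.

Lemma dotv_sym G x y : G^T = G -> dotv x (G *m y) = dotv y (G *m x).
Proof. by move=> sG; rewrite dotvC /dotv trmx_mul sG mulmxA. Qed.

Lemma dotv_ge0 x : 0 <= dotv x x.
Proof. by rewrite dotvE sumr_ge0// => i _; rewrite -expr2 sqr_ge0. Qed.

Lemma dotv_eq0 x : dotv x x = 0 -> x = 0.
Proof.
rewrite dotvE => /eqP; rewrite psumr_eq0; last by move=> i _; rewrite -expr2 sqr_ge0.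
move=> /allP x0; apply/matrixP => i j; rewrite !mxE ord1.
by have := x0 i (mem_index_enum i); rewrite /= mulf_eq0 orbb => /eqP.
Qed.

(** The form is nonnegative at every [a *: x + b *: y]. Taking [a = r], [b = - q] gives
    [r * (p * r - q ^+ 2) >= 0], which settles the case [r > 0]. Since [G] is only semidefinite,
    [r = 0] is treated apart. *)
Lemma psd_cauchy_schwarz G x y : G^T = G -> (forall z, 0 <= dotv z (G *m z)) ->
  dotv x (G *m y) ^+ 2 <= dotv x (G *m x) * dotv y (G *m y).
Proof.
move=> sG psdG.
have H (a b : R) : 0 <= a ^+ 2 * dotv x (G *m x) + 2 * a * b * dotv x (G *m y)
    + b ^+ 2 * dotv y (G *m y).
  have := psdG (a *: x + b *: y).
  rewrite mulmxDr -!scalemxAr !dotvDl !dotvDr !dotvZl !dotvZr (dotv_sym y x sG).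
  by congr (_ <= _); ring.
move: H (psdG x) (psdG y); set p := dotv x _; set q := dotv x _; set r := dotv y _.
move=> H p0 r0; have [r_eq0|r_neq0] := eqVneq r 0.
  suff -> : q = 0 by rewrite expr0n/= mulr_ge0.
  have [//|q0] := eqVneq q 0.
  (* With [r = 0] and [q] nonzero the form is affine in [b]; this [b] would give it the value
     [-1]. *)
  have := H 1 (- (p + 1) / (2 * q)); rewrite r_eq0 mulr0 addr0 expr1n mul1r mulr1.
  have -> : 2 * (- (p + 1) / (2 * q)) * q = - (p + 1) by field.
  by rewrite subr_ge0 => ?; lra.
have rgt0 : 0 < r by rewrite lt_def r_neq0.
have := H r (- q); have -> : r ^+ 2 * p + 2 * r * - q * q + (- q) ^+ 2 * r =
  r * (p * r - q ^+ 2) by ring.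
by rewrite pmulr_rge0// subr_ge0.
Qed.

Lemma cauchy_schwarz_dotv x y : dotv x y ^+ 2 <= dotv x x * dotv y y.
Proof.
have := @psd_cauchy_schwarz 1%:M x y (trmx1 _ _); rewrite !mul1mx; apply.
by move=> z; rewrite mul1mx dotv_ge0.
Qed.

Lemma dotv_delta i x : dotv (delta_mx i 0) x = x i 0.
Proof.
rewrite dotvE (bigD1 i)//= big1 ?addr0; first by rewrite mxE !eqxx mul1r.
by move=> j ji; rewrite mxE (negbTE ji) mul0r.
Qed.

(** Each unit vector is a combination of [vs], so each coordinate of [y] is at most the sum [b i] of
    absolute coefficients times [Num.sqrt q]. The leading 1 in the constant secures positivity. *)
Lemma spanning_coercive (vs : seq 'cV[R]_d) : spanning vs ->
  exists2 a : R, 0 < a & forall y (q : R), 0 <= q ->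
    (forall x, x \in vs -> dotv x y ^+ 2 <= q) -> dotv y y <= a * q.
Proof.
move=> svs; pose c (i : 'I_d) j : R := coord (in_tuple vs) j (delta_mx i 0).
pose b (i : 'I_d) : R := \sum_j `|c i j|.
exists (1 + \sum_i b i ^+ 2).
  by rewrite (ltr_pwDl ltr01)// sumr_ge0// => i _; rewrite sqr_ge0.
move=> y q q0 vsq; rewrite mulrDl mul1r -[X in X <= _]add0r lerD// mulr_suml.
rewrite dotvE; apply: ler_sum => i _; rewrite -expr2.
have yi : y i 0 = \sum_j c i j * dotv vs`_j y.
  have : delta_mx i 0 \in <<in_tuple vs>>%VS by rewrite svs memvf.
  move=> /coord_span ei; rewrite -dotv_delta {1}ei dotvC dotv_sumr.
  by apply: eq_bigr => j _; rewrite dotvZr dotvC.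
have yb : `|y i 0| <= b i * Num.sqrt q.
  rewrite yi (le_trans (ler_norm_sum _ _ _))// mulr_suml ler_sum// => j _.
  rewrite normrM ler_wpM2l// -sqrtr_sqr ler_wsqrtr// vsq//.
  by rewrite mem_nth.
rewrite -[_ ^+ 2]real_normK ?num_real// -[X in _ <= _ * X]sqr_sqrtr// -exprMn.
by rewrite ler_pXn2r ?nnegrE// (le_trans _ yb).
Qed.

End DotProduct.

(** * Gram matrices *)

Lemma notin_span_free (R : realType) (d n : nat) (v : nat -> 'cV[R]_d) :
  (forall t, (0 < t <= n)%N -> v t \notin <<[seq v s | s <- iota 1 t.-1]>>%VS) ->
  free [seq v s | s <- iota 1 n].
Proof.
elim: n => [|n IH] vn; first by rewrite nil_free.
have -> : iota 1 n.+1 = iota 1 n ++ [:: n.+1] by rewrite -[in LHS](addn1 n) iotaD add1n.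
rewrite map_cat /= (perm_free (_ : perm_eq _ (v n.+1 :: [seq v s | s <- iota 1 n]))).
  rewrite free_cons; apply/andP; split; first exact: (vn n.+1 (leqnn _)).
  by apply: IH => t /andP[t0 tn]; rewrite vn// t0 leqW.
by rewrite perm_catC.
Qed.

Lemma free_spanning (R : realType) (d : nat) (vs : seq 'cV[R]_d) :
  free vs -> size vs = d -> spanning vs.
Proof.
move=> /eqP fvs svs; apply/eqP; rewrite eqEdim subvf/= fvs svs.
by rewrite dimvf /dim/= muln1.
Qed.

Section Gram.
Context {R : realType} {d : nat} {disp : measure_display} {T : measurableType disp}.
Variable X : nat -> T -> 'cV[R]_d.
Implicit Types (t : nat) (w : T).

Lemma gram_form t w y z :
  dotv y (gram X t w *m z) = \sum_(1 <= s < t.+1) dotv (X s w) y * dotv (X s w) z.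
Proof.
rewrite /gram mulmx_suml dotv_sumr; apply: eq_bigr => s _.
by rewrite -mulmxA (mx11_scalar ((X s w)^T *m z)) mul_mx_scalar dotvZr mulrC dotvC.
Qed.

Lemma gram_sym t w : (gram X t w)^T = gram X t w.
Proof.
rewrite /gram linear_sum/=; apply: eq_bigr => s _.
by rewrite trmx_mul trmxK.
Qed.

Lemma gram_quad t w y :
  dotv y (gram X t w *m y) = \sum_(1 <= s < t.+1) dotv (X s w) y ^+ 2.
Proof. by rewrite gram_form; apply: eq_bigr => s _; rewrite expr2. Qed.

Lemma gram_psd t w y : 0 <= dotv y (gram X t w *m y).
Proof. by rewrite gram_quad sumr_ge0// => s _; rewrite sqr_ge0. Qed.

(** By symmetry, a transposed row of the left kernel is annihilated by the Gram matrix, so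
    coercivity makes it zero. *)
Lemma gram_unit t w (a : R) :
  (forall y, dotv y y <= a * dotv y (gram X t w *m y)) -> gram X t w \in unitmx.
Proof.
move=> aG; rewrite -row_free_unit -kermx_eq0; apply/eqP/row_matrixP => i.
rewrite row0; apply: trmx_inj; rewrite trmx0; apply: dotv_eq0.
apply: le_anti; rewrite dotv_ge0 andbT (le_trans (aG _))//.
rewrite -[X in dotv _ (X *m _)]gram_sym -trmx_mul -row_mul mulmx_ker row0 trmx0.
by rewrite dotv0r mulr0.
Qed.

(** The constant has to be uniform in the outcome and in time. The first [d] actions form one of
    finitely many tuples of arms, and the sum of the constants of all tuples serves for each; later
    rounds only increase the quadratic form. *)
Lemma gram_coercive (arms : seq 'cV[R]_d) :
  (forall t w, (0 < t)%N -> X t w \in arms) ->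
  (forall t w, (0 < t <= d)%N ->
     X t w \notin <<[seq X s w | s <- iota 1 t.-1]>>%VS) ->
  exists2 a : R, 0 < a & forall t w y, (d <= t)%N ->
    dotv y y <= a * dotv y (gram X t w *m y).
Proof.
move=> Xarms Xspan.
have : forall s : d.-tuple (seq_sub arms), exists a : R, 0 < a /\
  (spanning (map val s) -> forall y (q : R), 0 <= q ->
   (forall x, x \in map val s -> dotv x y ^+ 2 <= q) -> dotv y y <= a * q).
  move=> s; have [/spanning_coercive[a a0 aP]|sNs] :=
    pselect (spanning (map val s)); first by exists a; split.
  (* A tuple that does not span gets a dummy constant. *)
  by exists 1; split.
move=> /choice[f fP]; exists (1 + \sum_s f s).
  by rewrite (ltr_pwDl ltr01)// sumr_ge0// => s _; rewrite ltW// (fP s).1.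
move=> t w y dt.
(* Entry [i], counted from 0, is the action of round [i.+1]. *)
pose s := mktuple (fun i : 'I_d => SeqSub (Xarms i.+1 w isT)).
have sE : map val s = [seq X k w | k <- iota 1 d].
  rewrite /= -map_comp (iotaDl 1 0) -map_comp -val_enum_ord -map_comp.
  by apply: eq_map => i.
have ss : spanning (map val s).
  rewrite sE; apply: free_spanning; last by rewrite size_map size_iota.
  by apply: notin_span_free => k; exact: Xspan.
have q0 := gram_psd t w y.
apply: (le_trans ((fP s).2 ss y _ q0 _)).
  move=> x; rewrite sE => /mapP[k]; rewrite mem_iota => /andP[k1 kd] ->.
  rewrite gram_quad (bigD1_seq k) ?iota_uniq//=; last first.
    by rewrite mem_index_iota k1 (leq_trans kd).
  by rewrite lerDl sumr_ge0// => j _; rewrite sqr_ge0.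
rewrite ler_wpM2r// (bigD1 s)//= addrCA lerDl addr_ge0// sumr_ge0// => i _.
exact/ltW/(fP i).1.
Qed.

End Gram.

(** * Least squares and optimism *)

Section LeastSquares.
Context {R : realType} {d : nat} {disp : measure_display} {T : measurableType disp}.
Context {P : probability T R}.
Variables (X : nat -> T -> 'cV[R]_d) (eta : nat -> {RV P >-> R}).
Variable theta : 'cV[R]_d.
Implicit Types (t : nat) (w : T).

Definition noise_sum t w : 'cV[R]_d := \sum_(1 <= s < t.+1) eta s w *: X s w.

Definition lse_error t w : 'cV[R]_d := invmx (gram X t w) *m noise_sum t w.

(** The squared Gram norm of the estimation error once the Gram matrix is invertible, see
    [deviation_gram]. *)
Definition deviation t w : R := dotv (lse_error t w) (noise_sum t w).

Definition width t w (x : 'cV[R]_d) : R := dotv x (invmx (gram X t w) *m x).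

Definition visits t w (x : 'cV[R]_d) : nat := \sum_(1 <= s < t.+1) (X s w == x).

Lemma lse_lse_error t w : gram X t w \in unitmx ->
  lse theta X eta t w = theta + lse_error t w.
Proof.
move=> Gu; rewrite /lse /lse_error /noise_sum /reward.
under eq_bigr do rewrite scalerDl.
rewrite big_split/= mulmxDr; congr (_ + _).
apply: (canLR (mulKmx Gu)); rewrite /gram mulmx_suml; apply: eq_bigr => s _.
by rewrite -mulmxA (mx11_scalar ((X s w)^T *m theta)) mul_mx_scalar.
Qed.

Lemma width_gram t w x : gram X t w \in unitmx ->
  let y := invmx (gram X t w) *m x in dotv y (gram X t w *m y) = width t w x.
Proof. by move=> Gu /=; rewrite mulKVmx// dotvC. Qed.

Lemma width_ge0 t w x : gram X t w \in unitmx -> 0 <= width t w x.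
Proof. by move=> Gu; rewrite -width_gram// gram_psd. Qed.

Lemma deviation_gram t w : gram X t w \in unitmx ->
  dotv (lse_error t w) (gram X t w *m lse_error t w) = deviation t w.
Proof. by move=> Gu; rewrite /deviation {2}/lse_error mulKVmx. Qed.

(** Cauchy-Schwarz in the Gram form, applied to the error and to the inverse Gram matrix times
    [x]. *)
Lemma lse_error_bound t w x : gram X t w \in unitmx ->
  dotv (lse_error t w) x ^+ 2 <= deviation t w * width t w x.
Proof.
move=> Gu; rewrite -deviation_gram// -width_gram//.
rewrite -[in leLHS](mulKVmx Gu x).
by apply: psd_cauchy_schwarz; [exact: gram_sym|exact: gram_psd].
Qed.

(** With [y] the inverse Gram matrix times [x], the width is the sum of [dotv (X s w) y ^+ 2] over
    the rounds; only the rounds that played [z] are kept. *)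
Lemma visits_width t w x z : gram X t w \in unitmx ->
  (visits t w z)%:R * dotv z (invmx (gram X t w) *m x) ^+ 2 <= width t w x.
Proof.
move=> Gu; rewrite -width_gram//= gram_quad /visits natr_sum mulr_suml.
apply: ler_sum => s _; case: eqP => [->|_]; first by rewrite mul1r.
by rewrite mul0r sqr_ge0.
Qed.

Lemma visits_width_self t w x : gram X t w \in unitmx ->
  (visits t w x)%:R * width t w x <= 1.
Proof.
move=> Gu; have := visits_width x x Gu; rewrite -/(width t w x).
have := width_ge0 x Gu; rewrite le_eqVlt => /orP[/eqP<-|v0]; first by rewrite mulr0.
by rewrite expr2 mulrA -[leRHS]mul1r ler_pM2r.
Qed.

Lemma wnormE t w x : wnorm (invmx (gram X t w)) x = Num.sqrt (width t w x).
Proof. by []. Qed.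

(** The bonus of [x] covers its underestimation, so optimism leaves a gap of at most the bonus of
    the played arm plus its estimation error, that is, twice its bonus. Squaring yields the factor
    4. *)
Lemma optimism_gap (beta : nat -> R) t w x (delta : R) :
  gram X t w \in unitmx -> deviation t w <= beta t.+1 ->
  ucb theta X eta beta t.+1 w x <= ucb theta X eta beta t.+1 w (X t.+1 w) ->
  0 <= delta <= dotv x theta - dotv (X t.+1 w) theta ->
  delta ^+ 2 <= 4 * beta t.+1 * width t w (X t.+1 w).
Proof.
move=> Gu devb; rewrite /ucb /= !wnormE lse_lse_error// !dotvDl => ucbX /andP[d0 dx].
have dev0 : 0 <= deviation t w by rewrite -deviation_gram// gram_psd.
have b0 : 0 <= beta t.+1 by rewrite (le_trans dev0).
have H z : `|dotv (lse_error t w) z| <= Num.sqrt (width t w z) * Num.sqrt (beta t.+1).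
  rewrite -sqrtr_sqr -sqrtrM ?width_ge0// ler_wsqrtr// mulrC.
  by rewrite (le_trans (lse_error_bound _ Gu))// ler_wpM2r// width_ge0.
have := H x; have := H (X t.+1 w); rewrite !ler_norml => /andP[_ H1] /andP[H2 _].
have -> : 4 * beta t.+1 * width t w (X t.+1 w) =
  (2 * (Num.sqrt (width t w (X t.+1 w)) * Num.sqrt (beta t.+1))) ^+ 2.
  by rewrite !exprMn !sqr_sqrtr ?width_ge0//; ring.
rewrite ler_pXn2r ?nnegrE// ?mulr_ge0 ?sqrtr_ge0//.
rewrite (dotvC x) (dotvC (X t.+1 w)) in dx; lra.
Qed.

End LeastSquares.

(** * Optimal play on a path where the confidence bounds hold *)

Section OptimalPlay.
Context {R : realType} {d M : nat} {disp : measure_display} {T : measurableType disp}.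
Context {P : probability T R}.
Variables (A : 'I_M -> {fset 'cV[R]_d}) (theta : 'cV[R]_d) (xstar : 'I_M -> 'cV[R]_d).
Variables (c : nat -> T -> 'I_M) (X : nat -> T -> 'cV[R]_d) (eta : nat -> {RV P >-> R}).
Variables (beta : nat -> R) (delta b a : R) (h t : nat) (w : T).

Hypothesis X_avail : forall s, (0 < s)%N -> X s w \in A (c s w).
Hypothesis xstar_avail : forall m, xstar m \in A m.
Hypothesis arm_norm : forall m x, x \in A m -> dotv x x <= 1.
Hypothesis delta_gt0 : 0 < delta.
Hypothesis gap : forall m x, x \in A m -> x != xstar m ->
  delta <= dotv (xstar m) theta - dotv x theta.
Hypothesis ucb_max : forall s, (h <= s <= t)%N -> forall x, x \in A (c s.+1 w) ->
  ucb theta X eta beta s.+1 w x <= ucb theta X eta beta s.+1 w (X s.+1 w).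
Hypothesis Gu : forall s, (h <= s <= t)%N -> gram X s w \in unitmx.
Hypothesis dev : forall s, (h <= s <= t)%N -> deviation X eta s w <= beta s.+1.
Hypothesis beta_b : forall s, (h <= s <= t)%N -> beta s.+1 <= b.

Lemma suboptimal_width s : (h <= s <= t)%N -> X s.+1 w != xstar (c s.+1 w) ->
  delta ^+ 2 <= 4 * b * width X s w (X s.+1 w).
Proof.
move=> hst Xs; apply: (@le_trans _ _ (4 * beta s.+1 * width X s w (X s.+1 w))).
  apply: (@optimism_gap _ _ _ _ _ X eta theta beta s w (xstar (c s.+1 w))) => //.
  - exact: Gu.
  - exact: dev.
  - exact: ucb_max.
  - by rewrite ltW//= gap// X_avail.
by rewrite ler_wpM2r ?width_ge0 ?Gu// ler_pM2l// beta_b.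
Qed.

(** At its last such play the arm still has a large width, hence fewer than [J] earlier visits; that
    play adds one. Only plays in context [m] are counted, because [x] may be optimal in another
    context. *)
Lemma suboptimal_plays (J : nat) m x n : 4 * b < J%:R * delta ^+ 2 ->
  x != xstar m -> (n <= t)%N ->
  (\sum_(h.+1 <= s < n.+1) ((c s w == m) && (X s w == x)) <= J)%N.
Proof.
move=> bJ xm; elim: n => [|n IH] nt; first by rewrite big_geq.
have [hn|nh] := ltnP h n.+1; last by rewrite big_geq.
rewrite big_nat_recr//=.
have [/andP[/eqP cm /eqP Xx]|_] := boolP ((c n.+1 w == m) && (X n.+1 w == x)); last first.
  by rewrite addn0 IH// ltnW.
have hnt : (h <= n <= t)%N by rewrite -ltnS hn ltnW.
have := @suboptimal_width _ hnt; rewrite cm Xx => /(_ xm) dv.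
have vis : ((visits X n w x)%:R * delta ^+ 2 <= 4 * b).
  have := visits_width_self x (Gu hnt) => v1.
  have dvis : (visits X n w x)%:R * delta ^+ 2 <=
    4 * b * ((visits X n w x)%:R * width X n w x).
    by rewrite [leRHS]mulrCA ler_wpM2l.
  have b0 : 0 <= 4 * b.
    have := width_ge0 x (Gu hnt); rewrite le_eqVlt => /orP[/eqP v0|v0].
      by move: dv; rewrite -v0 mulr0 leNgt exprn_gt0.
    by rewrite -(pmulr_lge0 _ v0) (le_trans _ dv)// sqr_ge0.
  by rewrite (le_trans dvis)// ler_piMr.
have vJ : (visits X n w x < J)%N.
  have := le_lt_trans vis bJ.
  by rewrite ltr_pM2r ?exprn_gt0// ltr_nat.
rewrite addn1 (leq_ltn_trans _ vJ)// /visits.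
rewrite (big_cat_nat (n := h.+1) (m := 1))//=.
rewrite (leq_trans _ (leq_addl _ _))// leq_sum// => s _.
by case: (X s w == x); rewrite ?andbF ?leq_b1.
Qed.

(** Suboptimal arms absorb at most [J] occurrences of their context each, so every optimal arm is
    visited [J'] times. The optimal arms control all directions, so every width is at most [a / J'],
    too small for a suboptimal play. *)
Lemma optimal_play (J J' : nat) :
  (forall y (q : R), 0 <= q -> (forall m, dotv (xstar m) y ^+ 2 <= q) ->
     dotv y y <= a * q) ->
  (h <= t)%N -> 0 <= a -> 0 <= b ->
  4 * b < J%:R * delta ^+ 2 -> 4 * b * a < J'%:R * delta ^+ 2 ->
  (forall m, (#|` A m | * J + J' <= \sum_(h.+1 <= s < t.+1) (c s w == m))%N) ->
  X t.+1 w = xstar (c t.+1 w).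
Proof.
move=> coer ht a0 b0 bJ bJ' cnt; apply/eqP; apply: contraLR bJ' => Xt.
have htt : (h <= t <= t)%N by rewrite ht leqnn.
have vis m : (J' <= visits X t w (xstar m))%N.
  rewrite -(leq_add2l (#|` A m | * J)) (leq_trans (cnt m))//.
  (* The occurrences of context [m] are split by the arm played: the optimal one or one of the
     others. *)
  apply: (@leq_trans (\sum_(h.+1 <= s < t.+1) (X s w == xstar m) +
    \sum_(x <- A m | x != xstar m)
      \sum_(h.+1 <= s < t.+1) ((c s w == m) && (X s w == x))))%N.
    rewrite exchange_big -big_split/= !big_nat; apply: leq_sum => s /andP[hs _].
    have [cm|//] := eqVneq (c s w) m.
    have [//|Xm] := eqVneq (X s w) (xstar m); rewrite add0n.
    rewrite (big_rem (X s w))/= ?Xm ?eqxx//.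
    by rewrite -cm X_avail// (leq_trans _ hs).
  rewrite addnC leq_add//.
    apply: (@leq_trans (\sum_(x <- A m | x != xstar m) J)%N).
      by apply: leq_sum => x xm; exact: suboptimal_plays.
    by rewrite big_const_seq iter_addn_0 mulnC leq_mul// count_size.
  rewrite /visits (big_cat_nat (n := h.+1) (m := 1))//=.
  exact: leq_addl.
rewrite -leNgt; set x := X t.+1 w; pose y := invmx (gram X t w) *m x.
have v0 := width_ge0 x (Gu htt).
have dv : delta ^+ 2 <= 4 * b * width X t w x by apply: suboptimal_width.
have vgt0 : 0 < width X t w x.
  rewrite lt_def v0 andbT; apply: contraTneq dv => ->.
  by rewrite mulr0 -ltNge exprn_gt0.
have [->|J'0] := posnP J'; first by rewrite mul0r !mulr_ge0.
have J'R : 0 < J'%:R :> R by rewrite ltr0n.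
(* [visits_width] bounds the product of [y] with each optimal arm; coercivity turns this into a
   bound on [y] itself. *)
have yy : dotv y y <= a * (width X t w x / J'%:R).
  apply: coer => [|m]; first by rewrite divr_ge0.
  rewrite ler_pdivlMr// mulrC (le_trans _ (visits_width x (xstar m) (Gu htt)))//.
  by rewrite ler_wpM2r ?sqr_ge0// ler_nat.
(* The width equals [dotv x y], so Cauchy-Schwarz and the bound on [y] give an inequality of the
   form [v ^+ 2 <= a * v / J'], to be divided by [v]. *)
have vJ : width X t w x * J'%:R <= a.
  have xy : width X t w x * width X t w x <= a * (width X t w x / J'%:R).
    rewrite -expr2 (le_trans (cauchy_schwarz_dotv _ _))//.
    by rewrite (le_trans _ yy)// ler_piMl ?dotv_ge0// (arm_norm (X_avail _)).
  by rewrite -(ler_pM2l vgt0) mulrA -ler_pdivlMr// (le_trans xy)// mulrCA mulrA.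
rewrite (le_trans (ler_wpM2l (ltW J'R) dv))//.
by rewrite mulrC -!mulrA ler_wpM2l// ler_wpM2l.
Qed.

End OptimalPlay.

(** * Deviation bound from a grid *)

(** The shift by [B] makes [k i] encode an integer between [-B] and [B], so that the grid is indexed
    by a finite type. It is used with [B = t ^ 3] and [r = t]. *)
Definition grid_point (R : realType) (d B r : nat)
    (k : {ffun 'I_d -> 'I_(2 * B).+1}) : 'cV[R]_d :=
  \col_i (((k i)%:R - B%:R) / r%:R).

Lemma grid_point_int (R : realType) (d B r : nat) (z : 'I_d -> int) :
  (forall i, `|z i| <= B%:Z) ->
  exists k : {ffun 'I_d -> 'I_(2 * B).+1},
    grid_point R r k = \col_i ((z i)%:~R / r%:R) :> 'cV[R]_d.
Proof.
move=> zB; exists [ffun i => inord (absz (z i + B%:Z))].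
apply/matrixP => i j; rewrite !mxE ffunE.
have := zB i; rewrite ler_norml => /andP[z1 z2].
have zi : (absz (z i + B%:Z))%:Z = z i + B%:Z by rewrite gez0_abs//; lra.
rewrite inordK; last by rewrite ltnS -lez_nat zi; lra.
have -> : (absz (z i + B%:Z))%:R = (z i + B%:Z)%:~R :> R by rewrite -zi.
by rewrite intrD addrK.
Qed.

Lemma grid_point_round (R : realType) (d B r : nat) (u : 'cV[R]_d) : (0 < r)%N ->
  (forall i, `|u i 0 * r%:R| <= B%:R) ->
  exists k : {ffun 'I_d -> 'I_(2 * B).+1},
    forall i, `|u i 0 - grid_point R r k i 0| <= r%:R^-1.
Proof.
move=> r0 uB; have rR : 0 < r%:R :> R by rewrite ltr0n.
have [i|k kE] := @grid_point_int R d B r (fun i => Num.floor (u i 0 * r%:R)).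
  have := uB i; rewrite !ler_norml => /andP[u1 u2]; apply/andP; split.
    by rewrite floor_ge_int rmorphN.
  by rewrite -(ler_int R) (le_trans (floor_le _)).
exists k => i; rewrite kE mxE -[X in `|X - _|](mulfK (lt0r_neq0 rR)) -mulrBl.
rewrite normrM ger0_norm ?subr_ge0 ?floor_le// ger0_norm ?invr_ge0 ?ler0n//.
rewrite ler_piMl ?invr_ge0 ?ler0n//.
by have := floorD1_gt (u i 0 * r%:R); rewrite intrD => ?; lra.
Qed.

Section Likelihood.
Context {R : realType} {d : nat} {disp : measure_display} {T : measurableType disp}.
Context {P : probability T R}.
Variables (X : nat -> T -> 'cV[R]_d) (eta : nat -> {RV P >-> R}).

(** The Gaussian log-likelihood ratio of the parameter [theta + u] against [theta]. *)
Definition loglik (u : 'cV[R]_d) t w : R :=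
  dotv u (noise_sum X eta t w) - 2^-1 * dotv u (gram X t w *m u).

Lemma gram_le t w y : (forall s, (0 < s)%N -> dotv (X s w) (X s w) <= 1) ->
  dotv y (gram X t w *m y) <= t%:R * dotv y y.
Proof.
move=> X1; rewrite gram_quad.
have -> : t%:R * dotv y y = \sum_(1 <= s < t.+1) dotv y y.
  by rewrite sumr_const_nat subn1 mulr_natl.
rewrite !big_nat; apply: ler_sum => s /andP[s0 _].
by rewrite (le_trans (cauchy_schwarz_dotv _ _))// ler_piMl ?dotv_ge0// X1.
Qed.

(* The deviation is twice the maximum of the log-likelihood ratio, attained at the
   least-squares error; near the maximum the loss is quadratic in the rounding. *)
Lemma deviation_grid t w (a L : R) : (0 < t)%N -> 0 <= a ->
  (forall y, dotv y y <= a * dotv y (gram X t w *m y)) ->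
  (forall s, (0 < s)%N -> dotv (X s w) (X s w) <= 1) ->
  (forall k : {ffun 'I_d -> 'I_(2 * t ^ 3).+1},
     loglik (grid_point R t k) t w <= L) ->
  L <= t%:R / 2 -> a ^+ 2 * d%:R <= t%:R ^+ 2 -> (d <= t)%N ->
  deviation X eta t w <= 2 * L + 1.
Proof.
move=> t0 a0 coer X1 gridL Lt adt dt.
have tR : 0 < t%:R :> R by rewrite ltr0n.
have t1 : 1 <= t%:R :> R by rewrite ler1n.
have Gu := gram_unit coer.
set S := noise_sum X eta t w; set u := lse_error X eta t w.
set G := gram X t w.
(* The signed unit vectors are grid points. There the log-likelihood is a signed coordinate of [S]
   minus half a diagonal Gram entry, which is at most [t]; so [L <= t / 2] bounds that coordinate by
   [t]. *)
have Sie (i : 'I_d) (e : bool) : (-1) ^+ e * S i 0 <= t%:R.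
  have [j|k kE] := @grid_point_int R d (t ^ 3) t
      (fun j => (-1) ^+ e * ((j == i) * t)%N%:Z).
    rewrite normrM normrX normrN1 expr1n mul1r ger0_norm// lez_nat.
    by rewrite expnS (leq_trans (leq_mul (leq_b1 _) (leqnn t)))// mul1n leq_pmulr// expn_gt0 t0.
  have := gridL k; have -> : grid_point R t k = (-1) ^+ e *: delta_mx i 0.
    rewrite kE; apply/matrixP => j l; rewrite !mxE ord1 eqxx andbT.
    rewrite intrM rmorphXn/= rmorphN1 -mulrA; congr (_ * _).
    by rewrite -pmulrn natrM mulfK// gt_eqF.
  rewrite /loglik dotvZl -scalemxAr dotvZr dotvZl mulrA -expr2 -exprM mulnC exprM.
  rewrite sqrrN !expr1n mul1r dotv_delta -/S => SL.
  have ee : dotv (delta_mx i 0) (delta_mx i 0 : 'cV[R]_d) = 1.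
    by rewrite dotv_delta mxE !eqxx.
  by have := gram_le t (delta_mx i 0) X1; rewrite ee mulr1 => Gi; lra.
have SS : dotv S S <= d%:R * t%:R ^+ 2.
  have -> : d%:R * t%:R ^+ 2 = \sum_(i < d) t%:R ^+ 2 :> R.
    by rewrite sumr_const card_ord mulr_natl.
  rewrite dotvE; apply: ler_sum => i _; rewrite -expr2 -[leLHS]real_normK ?num_real//.
  rewrite ler_pXn2r ?nnegrE//.
  by rewrite ler_norml; have := Sie i true; have := Sie i false; rewrite expr0 expr1 => ? ?; lra.
have qE : dotv u (G *m u) = dotv u S by rewrite deviation_gram.
have q0 : 0 <= dotv u S by rewrite -qE gram_psd.
have uu : dotv u u <= a * dotv u S by rewrite -qE coer.
have qS : dotv u S <= a * dotv S S.
  have [->|qn0] := eqVneq (dotv u S) 0; first by rewrite mulr_ge0// dotv_ge0.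
  have qgt0 : 0 < dotv u S by rewrite lt_def qn0.
  rewrite -(ler_pM2l qgt0) -expr2 (le_trans (cauchy_schwarz_dotv _ _))//.
  by rewrite mulrA [_ * a]mulrC ler_wpM2r// dotv_ge0.
(* This places the maximiser [u] inside the box covered by the grid. *)
have uu4 : dotv u u <= t%:R ^+ 2 * t%:R ^+ 2.
  have H1 : a * dotv u S <= a * (a * dotv S S) by rewrite ler_wpM2l.
  have H2 : a * (a * dotv S S) <= a * (a * (d%:R * t%:R ^+ 2)) by rewrite !ler_wpM2l.
  have H3 : a ^+ 2 * d%:R * t%:R ^+ 2 <= t%:R ^+ 2 * t%:R ^+ 2 by rewrite ler_wpM2r// sqr_ge0.
  have H4 : a * (a * (d%:R * t%:R ^+ 2)) = a ^+ 2 * d%:R * t%:R ^+ 2 by ring.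
  by rewrite (le_trans uu)// (le_trans H1)// (le_trans H2)// H4.
have [i|k kP] := @grid_point_round R d (t ^ 3) t u t0.
  rewrite normrM (ger0_norm (ltW tR)) natrX exprSr ler_wpM2r ?ler0n//.
  rewrite -(ler_pXn2r (n := 2)) ?nnegrE ?sqr_ge0//.
  rewrite real_normK ?num_real// [leRHS]expr2 (le_trans _ uu4)//.
  rewrite dotvE (bigD1 i)//= -expr2 lerDl sumr_ge0// => j _.
  by rewrite -expr2 sqr_ge0.
have := gridL k; set v := grid_point R t k in kP *; rewrite /loglik -/S -/G => vL.
have vS : dotv v S = dotv v (G *m u) by rewrite /u /lse_error mulKVmx.
(* Each coordinate is off by at most [1 / t] and the Gram form is at most [t] times the squared
   norm, so the loss is at most [d / t <= 1]. *)
have rnd : dotv (u - v) (G *m (u - v)) <= 1.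
  rewrite (le_trans (gram_le t _ X1))//.
  apply: (@le_trans _ _ (t%:R * (d%:R * t%:R^-1 ^+ 2))).
    rewrite ler_wpM2l ?ler0n//.
    have -> : d%:R * t%:R^-1 ^+ 2 = \sum_(i < d) t%:R^-1 ^+ 2 :> R.
      by rewrite sumr_const card_ord mulr_natl.
    rewrite dotvE; apply: ler_sum => i _; rewrite -expr2 -[leLHS]real_normK ?num_real//.
    rewrite ler_pXn2r ?nnegrE ?invr_ge0//.
    by have := kP i; rewrite !mxE.
  have -> : t%:R * (d%:R * t%:R^-1 ^+ 2) = d%:R / t%:R :> R by field; rewrite gt_eqF.
  by rewrite ler_pdivrMr// mul1r ler_nat.
have uGv : dotv u (G *m v) = dotv v (G *m u) by rewrite dotv_sym ?gram_sym.
(* Completing the square: twice the log-likelihood at [v] is the deviation minus the Gram form of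
   [u - v]. *)
move: rnd; rewrite mulmxBr !dotvBl !dotvBr qE uGv.
by rewrite /deviation -/u -/S; lra.
Qed.

Lemma near_ln_le (C : R) : \forall t \near \oo, C * ln t.+1%:R <= t%:R.
Proof.
near=> t.
have t1 : 1 <= t%:R :> R by rewrite ler1n; near: t; exact: nbhs_infty_gt.
have [C0|C0] := leP C 0.
  by rewrite (le_trans (y := 0))// mulr_le0_ge0// ln_ge0// ler1n.
have tC : 8 * C ^+ 2 <= t%:R by near: t; exact: nbhs_infty_ger.
have t0 : 0 < Num.sqrt t.+1%:R :> R by rewrite sqrtr_gt0 ltr0n.
(* Writing the logarithm as twice that of the square root bounds it by [2 * Num.sqrt t.+1%:R], whose
   square is linear in [t]. *)
rewrite -[t.+1%:R]sqr_sqrtr ?ler0n// lnXn// mulr2n.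
have lns := ltW (ln_sublinear t0).
apply: (@le_trans _ _ (2 * C * Num.sqrt t.+1%:R)).
  by rewrite -mulrA mulrCA ler_pM2l//; lra.
rewrite -(ler_pXn2r (n := 2)) ?nnegrE ?mulr_ge0 ?sqrtr_ge0 ?(ltW C0)//.
rewrite exprMn sqr_sqrtr ?ler0n// -natr1.
have := ler_wpM2r (ler0n R t) tC; nra.
Unshelve. all: by end_near. Qed.

(** Every term of the sum is below the threshold, which is at most [t ^ (4 * d + 3)] because
    [2 * t ^ 3 + 1 <= t ^ 4]. So [deviation_grid] applies with [L = (4 * d + 3) * ln t]. *)
Lemma near_deviation_beta (a : R) : (0 < d)%N -> 0 <= a ->
  (forall s w, (0 < s)%N -> dotv (X s w) (X s w) <= 1) ->
  \forall t \near \oo, forall w,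
  (forall y, dotv y y <= a * dotv y (gram X t w *m y)) ->
  \sum_(k : {ffun 'I_d -> 'I_(2 * t ^ 3).+1}) expR (loglik (grid_point R t k) t w)
    < ((2 * t ^ 3).+1 ^ d * t ^ 3)%:R ->
  deviation X eta t w <= 16 * d%:R * ln t.+1%:R.
Proof.
move=> d0 a0 X1; near=> t; move=> w coer Z.
have t3 : (3 <= t)%N by near: t; exact: nbhs_infty_ge.
have tR : 0 < t%:R :> R by rewrite ltr0n (leq_trans _ t3).
have dR : 1 <= d%:R :> R by rewrite ler1n.
have lnt : 0 <= ln t%:R :> R by rewrite ln_ge0// ler1n (leq_trans _ t3).
have ltt1 : ln t%:R <= ln t.+1%:R :> R by rewrite ler_ln ?posrE ?ler_nat ?ltr0n// (leq_trans _ t3).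
have ln1 : 1 <= ln t.+1%:R :> R.
  rewrite -[leLHS]expRK ler_ln ?posrE ?expR_gt0 ?ltr0n//.
  apply: (@le_trans _ _ t%:R); last by rewrite ler_nat.
  by near: t; exact: nbhs_infty_ger.
(* Origin of the 16: for [d >= 1] and [ln t.+1 >= 1], [(8 * d + 6) * ln t + 1] is at most
   [15 * d * ln t.+1]. *)
apply: (@le_trans _ _ (2 * ((4 * d + 3)%:R * ln t%:R) + 1)); last first.
  rewrite natrD natrM; nra.
apply: (deviation_grid (a := a)) => //.
- exact: leq_trans t3.
- by move=> s; exact: X1.
- move=> k; have t0N : (0 < t)%N by exact: leq_trans t3.
  have : expR (loglik (grid_point R t k) t w) <= t%:R ^+ (4 * d + 3).
    rewrite (le_trans (ltW (le_lt_trans _ Z)))//.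
      by rewrite (bigD1 k)//= lerDl sumr_ge0// => j _; rewrite expR_ge0.
    rewrite -natrX ler_nat expnD leq_mul// expnM leq_exp2r//.
    rewrite [leqRHS]expnSr mulnC.
    have : (3 * t ^ 3 <= t * t ^ 3)%N by rewrite leq_mul.
    have : (0 < t ^ 3)%N by rewrite expn_gt0 t0N.
    set z := (t ^ 3)%N; rewrite mulnC; lia.
  by rewrite -[leRHS]lnK ?posrE ?exprn_gt0// ler_expR lnXn// mulr_natl.
- have tt : 2 * (4 * d + 3)%:R * ln t.+1%:R <= t%:R :> R.
    by near: t; exact: near_ln_le.
  rewrite ler_pdivlMr//; nra.
- have t1 : 1 <= t%:R :> R by rewrite ler1n (leq_trans _ t3).
  rewrite expr2; apply: (@le_trans _ _ t%:R); first by near: t; exact: nbhs_infty_ger.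
  by rewrite ler_pMr.
- by near: t; exact: nbhs_infty_ge.
Unshelve. all: by end_near. Qed.

End Likelihood.

(** * Gaussian moments and independence *)

Section NormalMoments.
Context {R : realType}.
Local Open Scope ereal_scope.
Notation mu := (@lebesgue_measure R).

(** The Radon-Nikodym derivative and the explicit density have equal integrals over all measurable
    sets, hence agree almost everywhere. *)
Lemma ge0_integral_normal_prob (m s : R) (f : R -> \bar R) :
  measurable_fun setT f -> (forall x, 0 <= f x) ->
  \int[normal_prob m s]_x f x = \int[mu]_x (f x * (normal_pdf m s x)%:E).
Proof.
move=> mf f0; have dom := normal_prob_dominates m s.
have intf := Radon_Nikodym_SigmaFinite.f_integrable dom.
rewrite -(Radon_Nikodym_SigmaFinite.change_of_variables dom)//.
apply: ae_eq_integral => //.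
- apply: emeasurable_funM => //; exact: measurable_int intf.
- apply: emeasurable_funM => //; apply/measurable_EFinP; exact: measurable_normal_pdf.
- apply: ae_eqe_mul2l; apply: integral_ae_eq => //.
  + by apply/measurable_EFinP; exact: measurable_normal_pdf.
  + move=> E _ mE.
    by rewrite -Radon_Nikodym_SigmaFinite.f_integral.
Qed.

Lemma normal_prob_mgf (l : R) :
  \int[normal_prob 0 1]_x (expR (l * x))%:E = (expR (l ^+ 2 / 2))%:E.
Proof.
rewrite ge0_integral_normal_prob; last 2 first.
- by apply/measurable_EFinP; apply: measurableT_comp.
- by move=> x; rewrite lee_fin expR_ge0.
under eq_integral => x _.
  rewrite -EFinM.
  (* Completing the square recentres the density at [l]. *)
  have -> : (expR (l * x) * normal_pdf 0 1 x = expR (l ^+ 2 / 2) * normal_pdf l 1 x)%R.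
    rewrite !normal_pdfE ?oner_eq0// /normal_fun.
    rewrite mulrCA [RHS]mulrCA -!expRD; congr (_ * expR _)%R.
    by rewrite expr1n; field.
  rewrite EFinM; over.
rewrite ge0_integralZl_EFin ?expR_ge0//.
- by rewrite integral_normal_pdf mule1.
- by move=> x _; rewrite lee_fin normal_pdf_ge0.
- by apply/measurable_EFinP; exact: measurable_normal_pdf.
Qed.

End NormalMoments.

Section Independence.
Context {R : realType} {disp : measure_display} {T : measurableType disp}.
Variable P : probability T R.
Local Open Scope ereal_scope.

(** Independence identifies the joint law with the product of the marginal laws; Tonelli then
    factors the integral. *)
Lemma integral_indep_mul (f g : {RV P >-> R}) (b : R) :
  (forall A B, measurable A -> measurable B ->
     P (f @^-1` A `&` g @^-1` B) = P (f @^-1` A) * P (g @^-1` B)) ->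
  (forall w, 0 <= f w)%R -> (forall w, 0 <= g w)%R ->
  \int[P]_w (g w)%:E = b%:E ->
  \int[P]_w (f w * g w)%:E = b%:E * \int[P]_w (f w)%:E.
Proof.
move=> ind f0 g0 gb.
have b0 : 0 <= b%:E by rewrite -gb integral_ge0// => w _; rewrite lee_fin.
have mfg : measurable_fun setT (fun w => (f w, g w)) by exact: measurable_fun_pair.
pose fg : {RV P >-> (R * R)%type} := HB.pack (fun w => (f w, g w))
  (isMeasurableFun.Build _ _ _ _ _ mfg).
(* Absolute values make the integrand nonnegative on the whole plane without changing it on the
   range of the pair. *)
pose F (z : R * R) : \bar R := (`|z.1| * `|z.2|)%:E.
have mF : measurable_fun setT F.
  apply/measurable_EFinP; apply: measurable_funM; apply: measurableT_comp => //.
have F0 z : 0 <= F z by rewrite lee_fin mulr_ge0.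
transitivity (\int[distribution P fg]_z F z).
  rewrite ge0_integral_distribution//; apply: eq_integral => w _.
  by rewrite /F/= !ger0_norm.
transitivity (\int[distribution P f \x distribution P g]_z F z).
  by apply: eq_measure_integral => A mA _; apply/esym/product_measure_unique => //.
rewrite fubini_tonelli1//.
transitivity (\int[distribution P f]_x (`|x|%:E * b%:E)).
  apply: eq_integral => x _; rewrite /fubini_F/F/=.
  under eq_integral do rewrite EFinM.
  rewrite ge0_integralZl_EFin//; last first.
    by apply/measurable_EFinP.
  congr (_ * _); rewrite -gb ge0_integral_distribution//; last first.
    by apply/measurable_EFinP.
  by apply: eq_integral => w _ /=; rewrite ger0_norm.
rewrite ge0_integralZr//; last by apply/measurable_EFinP.
rewrite ge0_integral_distribution//; last by apply/measurable_EFinP.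
rewrite muleC; congr (_ * _); by apply: eq_integral => w _ /=; rewrite ger0_norm.
Qed.

Lemma measurable_fun_sigma_sub (G : set (set T)) (f : T -> R) :
  G `<=` measurable ->
  measurable_fun setT (f : g_sigma_algebraType G -> R) -> measurable_fun setT f.
Proof.
move=> Gm mf _ B mB; have := mf measurableT B mB.
by apply: smallest_sub => //; exact: sigma_algebra_measurable.
Qed.

(** Measurability is relative to the generated sigma-algebras, so that preimages under [f] and [g]
    lie in the independent systems. *)
Lemma integral_independent_systems (F G : set (set T)) (f g : T -> R) (b : R) :
  F `<=` measurable -> G `<=` measurable ->
  independent_systems P <<s F >> <<s G >> ->
  measurable_fun setT (f : g_sigma_algebraType F -> R) ->
  measurable_fun setT (g : g_sigma_algebraType G -> R) ->
  (forall w, 0 <= f w)%R -> (forall w, 0 <= g w)%R ->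
  \int[P]_w (g w)%:E = b%:E ->
  \int[P]_w (f w * g w)%:E = b%:E * \int[P]_w (f w)%:E.
Proof.
move=> Fm Gm ind mf mg f0 g0 gb.
have mfT := measurable_fun_sigma_sub Fm mf.
have mgT := measurable_fun_sigma_sub Gm mg.
pose f' : {RV P >-> R} := HB.pack f (isMeasurableFun.Build _ _ _ _ _ mfT).
pose g' : {RV P >-> R} := HB.pack g (isMeasurableFun.Build _ _ _ _ _ mgT).
apply: (@integral_indep_mul f' g' b) => // A B mA mB; apply: ind.
  by have := mf measurableT A mA; rewrite setTI.
by have := mg measurableT B mB; rewrite setTI.
Qed.

End Independence.

(** Any [f] will do, with no sigma-algebra on [V]: a preimage is a finite union of fibers of [X]. *)
Lemma measurable_fun_finite_range {d d' : measure_display} {T : measurableType d}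
  {T' : measurableType d'} (V : choiceType) (X : T -> V) (s : seq V) (f : V -> T') :
  (forall w, X w \in s) -> (forall x, measurable (X @^-1` [set x])) ->
  measurable_fun setT (f \o X).
Proof.
move=> Xs mX _ B mB; rewrite setTI.
have -> : (f \o X) @^-1` B =
    \big[setU/set0]_(x <- s) (if `[< B (f x) >] then X @^-1` [set x] else set0).
  apply/seteqP; split=> w /=.
    move=> Bw; rewrite -bigcup_seq; exists (X w) => //=.
    by rewrite (asboolT Bw).
  rewrite -bigcup_seq => -[x _]; case: asboolP => //= Bx ->.
  exact: Bx.
by apply: bigsetU_measurable => x _; case: ifP.
Qed.

(** * Exponential martingales of the interaction *)

Section Interaction.
Context {R : realType} {d M : nat} {disp : measure_display} {T : measurableType disp}.
Variables (P : probability T R) (A : 'I_M -> {fset 'cV[R]_d}) (p : 'I_M -> R).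
Variables (c : nat -> T -> 'I_M) (X : nat -> T -> 'cV[R]_d) (eta : nat -> {RV P >-> R}).
Variable arms : seq 'cV[R]_d.
Hypothesis int : interaction A p c X eta.
Hypothesis X_arms : forall t w, (0 < t)%N -> X t w \in arms.
Implicit Types (t s : nat) (w : T).

Lemma past_measurable t : past c X eta t `<=` measurable.
Proof.
move=> E [s /= /andP[s0 _]] [[|]|].
- by move=> [m ->]; exact: context_measurable int _ _ s0.
- by move=> [x ->]; exact: action_measurable int _ _ s0.
- by move=> [B mB <-]; rewrite setTI -[_ @^-1` _]setTI; exact: measurable_funP.
Qed.

Lemma context_fibers_measurable t : (0 < t)%N -> fibers (c t) `<=` measurable.
Proof. by move=> t0 E [m ->]; exact: context_measurable int _ _ t0. Qed.

Lemma pre_noise_measurable t : (0 < t)%N ->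
  past c X eta t `|` fibers (c t) `|` fibers (X t) `<=` measurable.
Proof.
move=> t0 E [[/past_measurable//|/(context_fibers_measurable t0)//]|[x ->]].
exact: action_measurable int _ _ t0.
Qed.

Lemma noise_events_measurable t : events_of (eta t) `<=` measurable.
Proof. by move=> E [B mB <-]; rewrite -[_ @^-1` _]setTI setIA setIid; exact: measurable_funP. Qed.

Lemma action_measurable_sub (G : set (set T)) s (f : 'cV[R]_d -> R) :
  (0 < s)%N -> fibers (X s) `<=` G ->
  measurable_fun setT ((f \o X s) : g_sigma_algebraType G -> R).
Proof.
move=> s0 XG; apply: (@measurable_fun_finite_range _ _ (g_sigma_algebraType G) _ _ (X s) arms f).
  by move=> w; exact: X_arms.
move=> x.
by apply: sub_sigma_algebra; apply: XG; exists x.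
Qed.

Lemma context_measurable_sub (G : set (set T)) s (f : 'I_M -> R) :
  fibers (c s) `<=` G ->
  measurable_fun setT ((f \o c s) : g_sigma_algebraType G -> R).
Proof.
move=> cG.
apply: (@measurable_fun_finite_range _ _ (g_sigma_algebraType G) _ _ (c s) (enum 'I_M) f).
  by move=> w; rewrite mem_enum.
move=> x.
by apply: sub_sigma_algebra; apply: cG; exists x.
Qed.

Lemma noise_measurable_sub (G : set (set T)) s :
  events_of (eta s) `<=` G ->
  measurable_fun setT ((eta s : T -> R) : g_sigma_algebraType G -> R).
Proof.
move=> eG _ B mB; apply: sub_sigma_algebra; apply: eG.
by exists B.
Qed.

Lemma past_sub s t : (0 < s < t)%N ->
  fibers (c s) `|` fibers (X s) `|` events_of (eta s) `<=` past c X eta t.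
Proof. by move=> st E Es; exists s. Qed.

Lemma noise_mgf t (l : R) : (0 < t)%N ->
  (\int[P]_w (expR (l * eta t w))%:E = (expR (l ^+ 2 / 2))%:E)%E.
Proof.
move=> t0; rewrite -normal_prob_mgf.
have meta : measurable_fun setT (eta t : T -> measurableTypeR R).
  by move=> _ B mB; exact: (@measurable_funP _ _ _ _ _ (eta t) measurableT B mB).
pose eta' : {RV P >-> measurableTypeR R} :=
  HB.pack (eta t : T -> measurableTypeR R) (isMeasurableFun.Build _ _ _ _ _ meta).
transitivity (\int[distribution P eta']_x (expR (l * x))%:E)%E; last first.
  by apply: eq_measure_integral => B mB _; exact: (noise_law int t0 mB).
rewrite ge0_integral_distribution//.
by apply/measurable_EFinP; apply: measurableT_comp.
Qed.

Lemma noise_tilt t (l : R) : (0 < t)%N ->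
  (\int[P]_w (expR (l * eta t w - 2^-1 * l ^+ 2))%:E = 1)%E.
Proof.
move=> t0; under eq_integral do rewrite addrC expRD EFinM.
rewrite ge0_integralZl_EFin ?expR_ge0//.
- by rewrite noise_mgf// -EFinM -expRD mulrC addNr expR0.
- by apply/measurable_EFinP; apply: measurableT_comp => //; exact: measurable_funM.
Qed.

Lemma expR_loglik u t w : expR (loglik X eta u t w) =
  \prod_(1 <= s < t.+1) expR (dotv u (X s w) * eta s w - 2^-1 * dotv u (X s w) ^+ 2).
Proof.
rewrite -expR_sum; congr expR; rewrite /loglik dotv_sumr gram_quad mulr_sumr -sumrB.
by apply: eq_bigr => s _; rewrite dotvZr mulrC (dotvC (X s w)).
Qed.

Lemma loglik_measurable_sub (G : set (set T)) u t :
  (forall s, (0 < s <= t)%N -> fibers (X s) `<=` G) ->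
  (forall s, (0 < s <= t)%N -> events_of (eta s) `<=` G) ->
  measurable_fun setT
    ((fun w => expR (loglik X eta u t w)) : g_sigma_algebraType G -> R).
Proof.
move=> XG eG; under eq_fun do rewrite expR_loglik.
apply: measurable_prod => s; rewrite mem_index_iota ltnS => /[dup] st /andP[s0 _].
apply: measurableT_comp => //; apply: measurable_funB.
  apply: measurable_funM; first exact: (action_measurable_sub (dotv u) s0 (XG _ st)).
  exact: noise_measurable_sub (eG _ st).
exact: (action_measurable_sub (fun x => 2^-1 * dotv u x ^+ 2) s0 (XG _ st)).
Qed.

Lemma loglik_measurable u t : measurable_fun setT (fun w => expR (loglik X eta u t w)).
Proof.
apply: (measurable_fun_sigma_sub (@past_measurable t.+1)).
apply: loglik_measurable_sub => s st E Es; apply: (@past_sub s t.+1 st).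
  by left; right.
by right.
Qed.

(** The likelihood ratio is a martingale with mean 1. The new factor depends on both the action and
    the noise of the round, so the integral is split by the value of the action; for each fixed
    value the factor depends on the fresh noise alone and has mean 1. *)
Lemma integral_expR_loglik u t : (\int[P]_w (expR (loglik X eta u t w))%:E = 1)%E.
Proof.
elim: t => [|t IH].
  under eq_integral do rewrite expR_loglik big_geq//.
  rewrite integral_cst// mul1e; exact: probability_setT.
pose W x w := expR (loglik X eta u t w) * (X t.+1 w == x)%:R.
pose g x w := expR (dotv u x * eta t.+1 w - 2^-1 * dotv u x ^+ 2).
pose G := past c X eta t.+1 `|` fibers (c t.+1) `|` fibers (X t.+1).
have mWG x : measurable_fun setT (W x : g_sigma_algebraType G -> R).
  apply: measurable_funM.
    apply: loglik_measurable_sub => s st E Es; left; left; apply: (@past_sub s t.+1 st).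
      by left; right.
    by right.
  apply: (action_measurable_sub (fun y => (y == x)%:R)) => // E EX.
  by right.
have mW x := measurable_fun_sigma_sub (pre_noise_measurable (ltn0Sn t)) (mWG x).
have W0 x w : 0 <= W x w by rewrite mulr_ge0 ?expR_ge0.
have g0 x w : 0 <= g x w by rewrite expR_ge0.
have mgG x : measurable_fun setT (g x : g_sigma_algebraType (events_of (eta t.+1)) -> R).
  apply: measurableT_comp => //; apply: measurable_funB => //.
  by apply: measurable_funM => //; exact: noise_measurable_sub.
have mg x := measurable_fun_sigma_sub (@noise_events_measurable t.+1) (mgG x).
(* Duplicates are removed from [arms] so that exactly one term of the sum survives. *)
have split_arm (F : 'cV[R]_d -> T -> R) w :
    \sum_(x <- undup arms) (expR (loglik X eta u t w) * (X t.+1 w == x)%:R) * F x w =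
    expR (loglik X eta u t w) * F (X t.+1 w) w.
  rewrite (bigD1_seq (X t.+1 w)) ?undup_uniq ?mem_undup ?X_arms//= eqxx mulr1.
  rewrite big1 ?addr0// => x xX; rewrite eq_sym (negbTE xX) mulr0 mul0r//.
transitivity (\int[P]_w \sum_(x <- undup arms) (W x w * g x w)%:E)%E.
  apply: eq_integral => w _; rewrite sumEFin split_arm; congr _%:E.
  by rewrite !expR_loglik big_nat_recr.
rewrite ge0_integral_sum//; last 2 first.
- by move=> x; apply/measurable_EFinP; exact: measurable_funM.
- by move=> x w _; rewrite lee_fin mulr_ge0.
transitivity (\sum_(x <- undup arms) \int[P]_w (W x w)%:E)%E.
  apply: eq_bigr => x _; rewrite -[RHS]mul1e.
  apply: (integral_independent_systems (pre_noise_measurable (ltn0Sn t))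
    (@noise_events_measurable t.+1)) => //; first exact: noise_fresh int _ _.
  exact: noise_tilt.
rewrite -ge0_integral_sum//; last 2 first.
- by move=> x; apply/measurable_EFinP.
- by move=> x w _; rewrite lee_fin.
rewrite -IH; apply: eq_integral => w _; rewrite sumEFin; congr _%:E.
by rewrite -[RHS]mulr1 -(split_arm (fun _ _ => 1)); apply: eq_bigr => x _; rewrite mulr1.
Qed.

Lemma context_count_measurable m h t :
  measurable_fun setT (fun w => \prod_(h.+1 <= s < t.+1) expR (- (c s w == m)%:R : R)).
Proof.
apply: (measurable_fun_sigma_sub (@past_measurable t.+1)).
apply: measurable_prod => s; rewrite mem_index_iota => /andP[hs st].
apply: (context_measurable_sub (fun l => expR (- (l == m)%:R))) => E Es.
by apply: (past_sub (s := s)); [rewrite (leq_trans _ hs)|left; left].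
Qed.

(** The Laplace transform at [-1] of a binomial count: each fresh context contributes a factor
    independent of the earlier ones. *)
Lemma integral_context_count m h t : (h <= t)%N ->
  (\int[P]_w (\prod_(h.+1 <= s < t.+1) expR (- (c s w == m)%:R))%:E =
   ((1 - p m * (1 - expR (- 1))) ^+ (t - h))%:E)%E.
Proof.
have int1 : (\int[P]_w (1%:E : \bar R) = 1)%E.
  by rewrite integral_cst// mul1e; exact: probability_setT.
elim: t => [|t IH].
  by rewrite leqn0 => /eqP->; under eq_integral do rewrite big_geq//.
rewrite leq_eqVlt => /orP[/eqP->|].
  by under eq_integral do rewrite big_geq//; rewrite subnn.
rewrite ltnS => ht; rewrite subSn// exprS EFinM -IH//.
under eq_integral do rewrite big_nat_recr//=.
apply: (@integral_independent_systems _ _ _ P (past c X eta t.+1) (fibers (c t.+1))).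
- exact: past_measurable.
- exact: context_fibers_measurable.
- exact: context_fresh int _ _.
- apply: measurable_prod => s; rewrite mem_index_iota => /andP[hs st].
  apply: (context_measurable_sub (fun l => expR (- (l == m)%:R))) => E Es.
  by apply: (past_sub (s := s)); [rewrite (leq_trans _ hs)|left; left].
- exact: (context_measurable_sub (fun l => expR (- (l == m)%:R))).
- by move=> w; rewrite prodr_ge0// => s _; rewrite expR_ge0.
- by move=> w; rewrite expR_ge0.
have mcm := context_measurable int m (ltn0Sn t).
have e1 : 0 <= 1 - expR (- 1 : R) by rewrite subr_ge0 -[leRHS]expR0 ler_expR lerN10.
set B := c t.+1 @^-1` [set m] in mcm *.
(* The factor is [expR (- 1)] on [B] and 1 off it, written as a sum of nonnegative terms. *)
transitivity (\int[P]_w ((expR (- 1))%:E + (1 - expR (- 1))%:E * (\1_(~` B) w)%:E))%E.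
  apply: eq_integral => w _; rewrite -EFinM -EFinD indicE; congr _%:E.
  have [cm|/eqP cm] := eqVneq (c t.+1 w) m.
    by rewrite memNset ?mulr0 ?addr0//= /B/=; apply.
  by rewrite mem_set// mulr1 subrKC oppr0 expR0.
rewrite ge0_integralD//; last first.
  apply/measurable_EFinP; apply: measurable_funM => //.
  by apply: measurable_indic; exact: measurableC.
rewrite ge0_integralZl_EFin//; last first.
  by apply/measurable_EFinP; apply: measurable_indic; exact: measurableC.
rewrite integral_indic//; last exact: measurableC.
rewrite setIT integral_cst//.
have PB : P (~` B) = (1 - (p m)%:E)%E.
  by rewrite -(context_law int m (ltn0Sn t)); exact: probability_setC.
transitivity ((expR (- 1))%:E * 1 + (1 - expR (- 1))%:E * (1 - (p m)%:E))%E.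
  by congr (_ * _ + _ * _)%E; [exact: probability_setT|exact: PB].
by rewrite mule1 -EFinB -EFinM -EFinD; congr _%:E; ring.
Qed.

Lemma noise_integrable t : (0 < t)%N -> P.-integrable setT (EFin \o eta t).
Proof.
move=> t0; apply/integrableP; split; first exact/measurable_EFinP.
apply: (@le_lt_trans _ _ (\int[P]_w ((expR (1 * eta t w))%:E + (expR (- 1 * eta t w))%:E)))%E.
  apply: ge0_le_integral => //.
  - by apply/measurableT_comp => //; exact/measurable_EFinP.
  - by apply: emeasurable_funD; apply/measurable_EFinP; apply: measurableT_comp => //;
      exact: measurable_funM.
  - move=> w _; rewrite /= -EFinD lee_fin mul1r mulN1r.
    have := expR_ge1Dx (eta t w); have := expR_ge1Dx (- eta t w).
    have := expR_ge0 (eta t w); have := expR_ge0 (- eta t w).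
    by case: (ger0P (eta t w)) => ? ? ? ? ?; lra.
rewrite ge0_integralD//.
- by rewrite !noise_mgf// -EFinD ltry.
- by apply/measurable_EFinP; apply: measurableT_comp => //; exact: measurable_funM.
- by apply/measurable_EFinP; apply: measurableT_comp => //; exact: measurable_funM.
Qed.

(* Integrating [1 + l * eta <= expR (l * eta)] gives [l * E eta <= expR (l ^ 2 / 2) - 1]
   for every [l] of either sign, which is [o(l)]. *)
Lemma noise_mean t : (0 < t)%N -> (\int[P]_w (eta t w)%:E = 0)%E.
Proof.
move=> t0; have ieta := noise_integrable t0.
have fin : (\int[P]_w (eta t w)%:E)%E \is a fin_num by exact: integrable_fin_num.
rewrite -(fineK fin); set m := fine _; congr _%:E.
have mE : (\int[P]_w (eta t w)%:E)%E = m%:E by rewrite fineK.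
have H l : 1 + l * m <= expR (l ^+ 2 / 2).
  rewrite -lee_fin -(@noise_mgf t l t0) EFinD EFinM -mE.
  rewrite -integralZl//.
  have -> : (1%:E = \int[P]_w (1%:E : \bar R))%E.
    by rewrite integral_cst// mul1e; apply/esym; exact: probability_setT.
  rewrite -integralD//; last 2 first.
  - exact: finite_measure_integrable_cst.
  - exact: integrableZl.
  apply: le_integral => //.
  - apply: integrableD => //; first exact: finite_measure_integrable_cst.
    exact: integrableZl.
  - apply/integrableP; split.
      by apply/measurable_EFinP; apply: measurableT_comp => //; exact: measurable_funM.
    under eq_integral do rewrite gee0_abs ?lee_fin ?expR_ge0//.
    by rewrite noise_mgf// ltry.
  - by move=> w _; rewrite -EFinM -EFinD lee_fin expR_ge1Dx.
(* For [l ^+ 2 <= 1], [expR (l ^+ 2 / 2)] is at most [1 / (1 - l ^+ 2 / 2)], hence at most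
   [1 + l ^+ 2]. *)
have H1 l : `|l| <= 1 -> l * m <= l ^+ 2.
  move=> l1; have l2 : l ^+ 2 <= 1 by rewrite -real_normK ?num_real// expr_le1.
  have l0 := sqr_ge0 l.
  have e1 := expR_ge1Dx (- (l ^+ 2 / 2)); rewrite expRN in e1.
  have e0 := expR_gt0 (l ^+ 2 / 2).
  have e2 : (1 - l ^+ 2 / 2) * expR (l ^+ 2 / 2) <= 1.
    by rewrite -ler_pdivlMr// mul1r.
  have := H l; nra.
(* Taking [l = m / 2] gives [m ^+ 2 / 2 <= m ^+ 2 / 4]. If that [l] exceeds 1 in absolute value,
   [l = 1] or [l = - 1] contradicts the size of [m]. *)
have [m0|m0|//] := ltgtP m 0.
  have [m1|m1] := leP (- 1) (m / 2).
    have m2 : `|m / 2| <= 1 by rewrite ler_norml m1/=; lra.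
    have := H1 _ m2; nra.
  have := H1 (- 1); rewrite normrN1 => /(_ (lexx _)); nra.
have [m1|m1] := leP (m / 2) 1.
  have m2 : `|m / 2| <= 1 by rewrite ler_norml m1 andbT; lra.
  have := H1 _ m2; nra.
have := H1 1; rewrite normr1 => /(_ (lexx _)); nra.
Qed.

End Interaction.

(** * Sums of inverse squares *)

Lemma pos_seq_lbound (R : realFieldType) (s : seq R) : (forall x, x \in s -> 0 < x) ->
  exists2 e : R, 0 < e & forall x, x \in s -> e <= x.
Proof.
elim: s => [|y s IH] s0; first by exists 1.
have [|e e0 es] := IH; first by move=> x xs; rewrite s0// inE xs orbT.
exists (Num.min y e); first by rewrite lt_min e0 s0// mem_head.
move=> x; rewrite inE => /orP[/eqP->|/es ex]; first by rewrite ge_min lexx.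
by rewrite ge_min ex orbT.
Qed.

Lemma sum_le_inv_sqr (R : realFieldType) (r : nat -> R) (D K : R) (t0 : nat) :
  (0 < t0)%N -> 0 <= K -> (forall t, (0 < t)%N -> r t <= D) ->
  (forall t, (t0 <= t)%N -> r t.+1 <= K / t%:R ^+ 2) -> 0 <= D ->
  forall n, \sum_(1 <= t < n.+1) r t <= D * t0%:R + 2 * K.
Proof.
move=> t00 K0 rD rK D0 n.
have small k : \sum_(1 <= t < k.+1) r t <= D * k%:R.
  apply: (@le_trans _ _ (\sum_(1 <= t < k.+1) D)).
    by rewrite !big_nat; apply: ler_sum => t /andP[t1 _]; exact: rD.
  by rewrite sumr_const_nat subn1 mulr_natr.
have [nt|tn] := leqP n t0.
  rewrite (le_trans (small n))// -[leLHS]addr0 lerD ?mulr_ge0//.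
  by rewrite ler_wpM2l// ler_nat.
(* Strengthened for induction: the slack [2 * K / k] pays for the next term, since [1 / k ^ 2] is at
   most twice [1 / k - 1 / (k + 1)]. *)
have large k : (t0 <= k)%N ->
    \sum_(1 <= t < k.+1) r t <= D * t0%:R + 2 * K * (1 - k%:R^-1).
  elim: k => [|k IH]; first by rewrite leqn0 => /eqP t0E; move: t00; rewrite t0E.
  rewrite leq_eqVlt => /orP[/eqP <-|].
    rewrite (le_trans (small _))// lerDl mulr_ge0 ?mulr_ge0// subr_ge0 invf_le1 ?ltr0n//.
    by rewrite ler1n.
  rewrite ltnS => tk; have k0 : 0 < k%:R :> R by rewrite ltr0n (leq_trans t00).
  have k1 : 1 <= k%:R :> R by rewrite ler1n (leq_trans t00).
  rewrite big_nat_recr//=; apply: (le_trans (lerD (IH tk) (rK _ tk))).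
  have : K / k%:R ^+ 2 <= 2 * K * (k%:R^-1 - k.+1%:R^-1).
    have -> : k%:R^-1 - k.+1%:R^-1 = (k%:R * k.+1%:R)^-1 :> R.
      by rewrite -[k.+1%:R]natr1; field; rewrite !gt_eqF// addr_gt0.
    rewrite -mulrA mulrCA ler_wpM2l// ler_pdivlMr ?mulr_gt0// ?ltr0n//.
    rewrite ler_pdivrMl ?exprn_gt0// -natr1; nra.
  set a := k%:R^-1; set a1 := k.+1%:R^-1; set e := K / _; lra.
by rewrite (le_trans (large n (ltnW tn)))// lerD2l ler_piMr ?mulr_ge0// gerBl invr_ge0.
Qed.

Lemma limn_esup_le_bound (R : realType) (u : (\bar R)^nat) (b : \bar R) :
  (forall n, u n <= b)%E -> (limn_esup u <= b)%E.
Proof.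
move=> ub; rewrite limn_esup_lim; apply: lime_le; first exact: is_cvg_esups.
by apply: nearW => n; apply: ge_ereal_sup => _ [k _ <-].
Qed.

Lemma half_window_sum (R : realFieldType) (t : nat) : (3 <= t)%N ->
  \sum_(t./2 <= j < t.+1) (j%:R ^+ 3)^-1 <= 27 / t%:R ^+ 2 :> R.
Proof.
(* The sum has at most [3 * t./2] terms, each at most the first; [t <= 3 * t./2] then turns
   [3 / (t./2) ^ 2] into [27 / t ^ 2]. *)
move=> t3; have h3 : (t <= 3 * t./2)%N by lia.
have h0 : (0 < t./2)%N by lia.
have hR : 0 < (t./2)%:R :> R by rewrite ltr0n.
apply: (@le_trans _ _ (\sum_(t./2 <= j < t.+1) ((t./2)%:R ^+ 3)^-1 : R)).
  rewrite !big_nat; apply: ler_sum => j /andP[hj _].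
  rewrite lef_pV2 ?posrE ?exprn_gt0// ?ltr0n ?(leq_trans h0)//.
  by rewrite lerXn2r ?nnegrE// ler_nat.
rewrite sumr_const_nat -[leLHS]mulr_natl.
apply: (@le_trans _ _ (3 / (t./2)%:R ^+ 2)).
  apply: (@le_trans _ _ ((3 * t./2)%:R / (t./2)%:R ^+ 3)).
    by rewrite ler_wpM2r ?invr_ge0 ?exprn_ge0 ?ler0n// ler_nat; lia.
  rewrite natrM.
  have -> : 3%:R * (t./2)%:R / (t./2)%:R ^+ 3 = 3 / (t./2)%:R ^+ 2 :> R.
    by field; rewrite gt_eqF.
  by [].
have tR : 0 < t%:R :> R by rewrite ltr0n; lia.
rewrite ler_pdivrMr ?exprn_gt0// mulrAC ler_pdivlMr ?exprn_gt0//.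
have : t%:R <= 3 * (t./2)%:R :> R by rewrite -natrM ler_nat.
nra.
Qed.

(** * Regret *)

Section Regret.
Context {R : realType} {d M : nat} {disp : measure_display} {T : measurableType disp}.
Variables (P : probability T R) (A : 'I_M -> {fset 'cV[R]_d}) (theta : 'cV[R]_d).
Variables (p : 'I_M -> R) (xstar : 'I_M -> 'cV[R]_d).
Variables (c : nat -> T -> 'I_M) (X : nat -> T -> 'cV[R]_d) (eta : nat -> {RV P >-> R}).
Hypothesis opt : unique_optimal A theta xstar.
Hypothesis int : interaction A p c X eta.

Definition arms : seq 'cV[R]_d := [seq x | m <- enum 'I_M, x <- enum_fset (A m)].

Lemma arms_mem m x : x \in A m -> x \in arms.
Proof. by move=> xA; apply/allpairsPdep; exists m, x; rewrite mem_enum. Qed.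

Lemma X_arms t w : (0 < t)%N -> X t w \in arms.
Proof. by move=> t0; apply: arms_mem; exact: action_available int _ w t0. Qed.

Definition arm_gap m x : R := dotv (xstar m) theta - dotv x theta.

Definition round_gap t w : R := arm_gap (c t w) (X t w).

Lemma round_gap_ge0 t w : (0 < t)%N -> 0 <= round_gap t w.
Proof.
move=> t0; rewrite subr_ge0; have [_ om] := opt (c t w).
have [->//|Xs] := eqVneq (X t w) (xstar (c t w)).
by apply/ltW/om => //; exact: action_available int _ w t0.
Qed.

Lemma arm_gap_ubound : exists2 D : R, 0 <= D & forall m x, x \in A m -> arm_gap m x <= D.
Proof.
exists (\sum_(m < M) \sum_(x <- A m) `|arm_gap m x|).
  by apply: sumr_ge0 => m _; exact: sumr_ge0.
move=> m x xA; rewrite (le_trans (ler_norm _))// (bigD1 m)//= (big_rem x)//= -addrA.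
by rewrite lerDl addr_ge0// ?sumr_ge0// => i _; exact: sumr_ge0.
Qed.

Lemma arm_gap_lbound : exists2 delta : R, 0 < delta &
  forall m x, x \in A m -> x != xstar m -> delta <= arm_gap m x.
Proof.
have [|e e0 eP] := @pos_seq_lbound R
  [seq arm_gap m x | m <- enum 'I_M, x <- [seq x <- enum_fset (A m) | x != xstar m]].
  move=> _ /allpairsPdep[m [x [_ + ->]]]; rewrite mem_filter => /andP[xm xA].
  by rewrite subr_gt0; apply: (opt m).2.
exists e => // m x xA xm; apply: eP; apply/allpairsPdep; exists m, x.
by rewrite mem_enum mem_filter xm.
Qed.

Lemma round_gap_measurable t : (0 < t)%N -> measurable_fun setT (round_gap t).
Proof.
move=> t0; apply: measurable_funB.
  apply: (@measurable_fun_finite_range _ _ _ _ _ (c t) (enum 'I_M)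
    (fun m => dotv (xstar m) theta)); first by move=> w; rewrite mem_enum.
  by move=> m; exact: context_measurable int _ _ t0.
apply: (@measurable_fun_finite_range _ _ _ _ _ (X t) arms (fun x => dotv x theta)).
  by move=> w; exact: X_arms.
by move=> x; exact: action_measurable int _ _ t0.
Qed.

Lemma round_gap_integrable t : (0 < t)%N -> P.-integrable setT (EFin \o round_gap t).
Proof.
move=> t0; have [D D0 DP] := arm_gap_ubound.
apply/integrableP; split; first by apply/measurable_EFinP; exact: round_gap_measurable.
apply: (@le_lt_trans _ _ (\int[P]_w (cst D%:E w)))%E.
  apply: ge0_le_integral => //.
  - by apply/measurableT_comp => //; apply/measurable_EFinP; exact: round_gap_measurable.
  - move=> w _; rewrite /= lee_fin ger0_norm ?round_gap_ge0//.
    by apply: DP; exact: action_available int _ w t0.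
rewrite integral_cst// lte_mul_pinfty// ?lee_fin//.
by rewrite -ge0_fin_numE//; exact: fin_num_measure.
Qed.

(** The noise has mean zero. Linearity of the integral needs integrability of the partial sums, so
    both are proved in one induction. *)
Lemma regretE n : regret theta c X eta xstar n =
  (\sum_(1 <= t < n.+1) \int[P]_w (round_gap t w)%:E)%E.
Proof.
rewrite /regret unlock.
have -> : (fun w => (\sum_(1 <= t < n.+1) dotv (xstar (c t w)) theta -
    \sum_(1 <= t < n.+1) reward theta X eta t w)%:E) =
  (fun w => (\sum_(1 <= t < n.+1) (round_gap t w - eta t w))%:E).
  apply/funext => w; congr _%:E; rewrite -sumrB; apply: eq_bigr => t _.
  by rewrite /round_gap /arm_gap /reward opprD addrA.
pose F t w := (round_gap t w - eta t w)%:E.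
have iF t : (0 < t)%N -> P.-integrable setT (F t).
  move=> t0; rewrite (_ : F t = (EFin \o round_gap t) \- (EFin \o eta t))%E//.
  apply: integrableB => //; first exact: round_gap_integrable.
  exact: noise_integrable int _ t0.
have intF t : (0 < t)%N -> (\int[P]_w F t w = \int[P]_w (round_gap t w)%:E)%E.
  move=> t0; rewrite integralB_EFin//; last 2 first.
  - exact: round_gap_integrable.
  - exact: noise_integrable int _ t0.
  by rewrite (noise_mean int t0) sube0.
have [_ ->//] : P.-integrable setT (fun w => (\sum_(1 <= t < n.+1) (round_gap t w - eta t w))%:E)
  /\ (\int[P]_w (\sum_(1 <= t < n.+1) (round_gap t w - eta t w))%:E =
  \sum_(1 <= t < n.+1) \int[P]_w (round_gap t w)%:E)%E.
elim: n => [|n [IH1 IH2]].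
  split.
    under eq_fun do rewrite big_geq//; exact: integrable0.
  by under eq_integral do rewrite big_geq//; rewrite big_geq// integral0.
under eq_fun do rewrite big_nat_recr//= EFinD.
split; first by apply: integrableD => //; exact: iF.
by rewrite integralD//; [rewrite IH2 intF// [RHS]big_nat_recr|exact: iF].
Qed.

Lemma context_proba_le1 : (forall m, 0 < p m) -> \sum_m p m = 1 -> forall m, p m <= 1.
Proof.
move=> p0 p1 m; rewrite -p1 (bigD1 m)//= lerDl sumr_ge0// => i _.
exact: ltW.
Qed.

(** Not normalised: its mean is the number of grid points. *)
Definition mixture t w : R :=
  \sum_(k : {ffun 'I_d -> 'I_(2 * t ^ 3).+1}) expR (loglik X eta (grid_point R t k) t w).

Lemma mixture_measurable t : measurable_fun setT (mixture t).
Proof. by apply: measurable_sum => k; exact: loglik_measurable int X_arms _ _. Qed.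

Lemma mixture_ge0 t w : 0 <= mixture t w.
Proof. by apply: sumr_ge0 => k _; exact: expR_ge0. Qed.

Lemma integral_mixture t : (\int[P]_w (mixture t w)%:E = ((2 * t ^ 3).+1 ^ d)%:R%:E)%E.
Proof.
under eq_integral do rewrite -sumEFin.
rewrite ge0_integral_sum//; last first.
  by move=> k; apply/measurable_EFinP; exact: loglik_measurable int X_arms _ _.
under eq_bigr do rewrite (integral_expR_loglik int X_arms).
by rewrite sumEFin sumr_const card_ffun !card_ord.
Qed.

(** The base of the power is at most [expR (- (p m / 2))] and the exponent at least [t / 2], so the
    power decays like [expR (- (p m / 4) * t)] and beats any power of [t.+1]. *)
Lemma near_context_tail m (kappa : R) : 0 < p m <= 1 ->
  \forall t \near \oo, expR (kappa * ln t.+1%:R) *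
    (1 - p m * (1 - expR (- 1))) ^+ (t - t./2) <= (t%:R ^+ 2)^-1.
Proof.
move=> /andP[p0 p1]; near=> t.
have t0 : (0 < t)%N by near: t; exact: nbhs_infty_gt.
have e2 : expR (- 1) <= 2^-1 :> R.
  rewrite expRN lef_pV2 ?posrE ?expR_gt0//.
  by have := expR_ge1Dx (1 : R).
have e0 := expR_gt0 (- 1 : R).
have tp : (kappa + 2) * (4 / p m) * ln t.+1%:R <= t%:R by near: t; exact: near_ln_le.
apply: (@le_trans _ _ (expR (kappa * ln t.+1%:R) * expR (- (p m / 2) * (t - t./2)%:R))).
  rewrite ler_wpM2l ?expR_ge0// expRM_natr lerXn2r ?nnegrE ?expR_ge0//.
    by rewrite subr_ge0; nra.
  by apply: (le_trans _ (expR_ge1Dx _)); nra.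
apply: (@le_trans _ _ (expR (- (ln t.+1%:R *+ 2)))); last first.
  rewrite expRN lef_pV2 ?posrE ?expR_gt0 ?exprn_gt0 ?ltr0n//.
  by rewrite -lnXn ?ltr0n// lnK ?posrE ?exprn_gt0 ?ltr0n// lerXn2r ?nnegrE// ler_nat.
rewrite -expRD ler_expR.
have th : t%:R / 2 <= (t - t./2)%:R :> R.
  by rewrite ler_pdivrMr// -natrM ler_nat; lia.
have : (kappa + 2) * ln t.+1%:R <= p m / 4 * t%:R.
  rewrite -(@ler_pM2l _ (4 / p m)) ?divr_gt0// mulrCA mulrA (mulrA (4 / p m) (p m / 4)).
  have -> : 4 / p m * (p m / 4) = 1 by field; rewrite gt_eqF.
  by rewrite mul1r.
nra.
Unshelve. all: by end_near. Qed.

End Regret.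

(** * Failure scores and the regret of a single round *)

Section BoundedRegret.
Context {R : realType} {d M K : nat} {disp : measure_display} {T : measurableType disp}.
Variables (P : probability T R) (A : 'I_M -> {fset 'cV[R]_d}) (theta : 'cV[R]_d).
Variables (p : 'I_M -> R) (xstar : 'I_M -> 'cV[R]_d).
Variables (c : nat -> T -> 'I_M) (X : nat -> T -> 'cV[R]_d) (eta : nat -> {RV P >-> R}).
Let beta (t : nat) : R := 16 * d%:R * ln t%:R.
Hypothesis sets : action_sets K A.
Hypothesis p_gt0 : forall m, 0 < p m.
Hypothesis p_sum : \sum_m p m = 1.
Hypothesis opt : unique_optimal A theta xstar.
Hypothesis span : spanning [seq xstar m | m : 'I_M].
Hypothesis int : interaction A p c X eta.
Hypothesis pol : optimistic A theta c X eta beta.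
Hypothesis d_gt0 : (0 < d)%N.

Local Notation gap_round := (round_gap theta xstar c X).

Lemma arm_norm_le1 m x : x \in A m -> dotv x x <= 1.
Proof.
move=> xA; have [_ _ /(_ _ xA)] := sets m.
rewrite /norm2 -[X in _ <= X -> _]sqrtr1 ler_sqrt//.
Qed.

(** The mixture over the threshold of [near_deviation_beta]: below 1 the confidence bound holds for
    large [t], and the mean is [t ^ -3]. *)
Definition mixture_score t w : R :=
  mixture X eta t w / ((2 * t ^ 3).+1 ^ d * t ^ 3)%:R.

(** A Chernoff weight: it is below 1 exactly when context [m] occurs more than [kappa * ln t.+1]
    times in the window. *)
Definition context_score (kappa : R) m t w : R :=
  expR (kappa * ln t.+1%:R) * \prod_(t./2.+1 <= s < t.+1) expR (- (c s w == m)%:R).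

Definition score kappa t w : R :=
  \sum_(t./2 <= j < t.+1) mixture_score j w + \sum_(m < M) context_score kappa m t w.

Lemma mixture_score_ge0 t w : 0 <= mixture_score t w.
Proof. by rewrite divr_ge0// mixture_ge0. Qed.

Lemma context_score_ge0 kappa m t w : 0 <= context_score kappa m t w.
Proof. by rewrite mulr_ge0 ?expR_ge0// prodr_ge0// => s _; exact: expR_ge0. Qed.

(** By contraposition: a score below 1 keeps each of its nonnegative summands below 1, and these
    supply the hypotheses of [optimal_play]. *)
Lemma near_suboptimal_score : exists kappa : R,
  \forall t \near \oo, forall w, X t.+1 w != xstar (c t.+1 w) -> 1 <= score kappa t w.
Proof.
have [delta delta0 gap] := arm_gap_lbound opt.
have [a1 a10 coer] := gram_coercive (X_arms int) pol.1.
have [a2 a20 coer2] := spanning_coercive span.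
pose u : R := 64 * d%:R / delta ^+ 2.
have u0 : 0 <= u by rewrite divr_ge0 ?sqr_ge0// mulr_ge0.
(* [u * ln t.+1] is [4 * b / delta ^+ 2] for the [b] below, so [kappa * ln t.+1] dominates
   [K * J + J']; the summand [K%:R + 1] absorbs the rounding of [J] and [J'] once the logarithm is
   at least 1. *)
pose kappa : R := u * (K%:R + a2) + K%:R + 1.
exists kappa.
have X1 s w : (0 < s)%N -> dotv (X s w) (X s w) <= 1.
  by move=> s0; apply: arm_norm_le1; exact: action_available int _ w s0.
have [N _ NP] := near_deviation_beta eta d_gt0 (ltW a10) X1.
near=> t; move=> w; apply: contraNle => small; apply/eqP.
(* The whole window then lies beyond [N] and beyond the [d] initial rounds. *)
have tN : (2 * (N + d).+2 <= t)%N by near: t; exact: nbhs_infty_ge.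
have hN : (N <= t./2)%N by lia.
have hd : (d <= t./2)%N by lia.
have h0 : (0 < t./2)%N by lia.
have ln1 : 1 <= ln t.+1%:R :> R.
  rewrite -[leLHS]expRK ler_ln ?posrE ?expR_gt0 ?ltr0n//.
  apply: (@le_trans _ _ t%:R); last by rewrite ler_nat.
  by near: t; exact: nbhs_infty_ger.
have mix0 : 0 <= \sum_(t./2 <= j < t.+1) mixture_score j w.
  by apply: sumr_ge0 => j _; exact: mixture_score_ge0.
have ctx0 : 0 <= \sum_(m < M) context_score kappa m t w.
  by apply: sumr_ge0 => m _; exact: context_score_ge0.
have mix_small j : (t./2 <= j <= t)%N -> deviation X eta j w <= beta j.+1.
  move=> /andP[hj jt]; apply: NP => /=; first exact: leq_trans hj.
    by move=> y; apply: coer; exact: leq_trans hj.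
  have j0 : (0 < j)%N by exact: leq_trans hj.
  rewrite -[ltLHS]/(mixture X eta j w) -[ltRHS]mul1r -ltr_pdivrMr; last first.
    by rewrite ltr0n muln_gt0 !expn_gt0 j0.
  apply: le_lt_trans small; rewrite /score (bigD1_seq j) ?iota_uniq ?mem_index_iota ?hj//=.
  rewrite -[leLHS]/(mixture_score j w) -addrA lerDl addr_ge0//.
  by apply: sumr_ge0 => i _; exact: mixture_score_ge0.
have ctx_small m : kappa * ln t.+1%:R < (\sum_(t./2.+1 <= s < t.+1) (c s w == m))%:R.
  rewrite -subr_lt0 -expR_lt1 expRD; apply: le_lt_trans small.
  rewrite natr_sum -sumrN expR_sum -[leLHS]/(context_score kappa m t w).
  rewrite /score (bigD1 m)//= addrCA lerDl addr_ge0// sumr_ge0// => i _.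
  exact: context_score_ge0.
pose b := beta t.+1; have b0 : 0 <= b by rewrite !mulr_ge0// ln_ge0// ler1n.
(* Adding one to the truncation gives the strict inequalities of [optimal_play]. *)
pose J := (Num.truncn (4 * b / delta ^+ 2)).+1.
pose J' := (Num.truncn (4 * b * a2 / delta ^+ 2)).+1.
have dl2 : 0 < delta ^+ 2 by rewrite exprn_gt0.
apply: (@optimal_play _ _ _ _ _ P A theta xstar c X eta beta delta b a2 (t./2) t w
  _ _ _ _ _ _ _ _ _ J J') => //.
- by move=> s s0; exact: action_available int _ w s0.
- by move=> m; have [] := opt m.
- exact: arm_norm_le1.
- move=> s /andP[hs _] x xA; apply: pol.2 => //; by rewrite ltnS (leq_trans hd).
- move=> s /andP[hs _]; apply: (@gram_unit _ _ _ _ _ _ _ a1) => y; apply: coer.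
  exact: leq_trans hs.
- move=> s /andP[_ st]; rewrite /b /beta ler_wpM2l// ?mulr_ge0//.
  by rewrite ler_ln ?posrE ?ltr0n// ler_nat.
- move=> y q q0 yq; apply: coer2 => // x /mapP[m _ ->]; exact: yq.
- lia.
- exact: ltW.
- by rewrite -ltr_pdivrMr// truncnS_gt.
- by rewrite -ltr_pdivrMr// truncnS_gt.
- move=> m; have [-> _ _] := sets m; rewrite -(ler_nat R).
  apply: le_trans (ltW (ctx_small m)); rewrite natrD natrM.
  have b4 : 0 <= 4 * b by exact: mulr_ge0.
  have JE : J%:R <= u * ln t.+1%:R + 1.
    rewrite /J -natr1 lerD2r.
    have -> : u * ln t.+1%:R = 4 * b / delta ^+ 2.
      by rewrite /u /b /beta; field; rewrite gt_eqF.
    by rewrite truncn_le// (divr_ge0 b4 (ltW dl2)).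
  have J'E : J'%:R <= u * a2 * ln t.+1%:R + 1.
    rewrite /J' -natr1 lerD2r.
    have -> : u * a2 * ln t.+1%:R = 4 * b * a2 / delta ^+ 2.
      by rewrite /u /b /beta; field; rewrite gt_eqF.
    by rewrite truncn_le// (divr_ge0 (mulr_ge0 b4 (ltW a20)) (ltW dl2)).
  have := ler_wpM2l (ler0n R K) JE; rewrite /kappa.
  have : 0 <= (K%:R + 1) * (ln t.+1%:R - 1) :> R.
    by apply: mulr_ge0; rewrite ?subr_ge0// addr_ge0.
  lra.
Unshelve. all: by end_near. Qed.

Lemma mixture_score_measurable t : measurable_fun setT (mixture_score t).
Proof. by apply: measurable_funM => //; exact: mixture_measurable int _. Qed.

Lemma integral_mixture_score t : (0 < t)%N ->
  (\int[P]_w (mixture_score t w)%:E = ((t%:R ^+ 3)^-1)%:E)%E.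
Proof.
move=> t0; under eq_integral do rewrite /mixture_score mulrC EFinM.
rewrite ge0_integralZl_EFin//.
- rewrite (integral_mixture int) -EFinM natrM (natrX _ t 3).
  set n : R := ((2 * t ^ 3).+1 ^ d)%:R.
  have n0 : n != 0 by rewrite pnatr_eq0 -lt0n expn_gt0.
  by rewrite invfM mulrAC mulVf// mul1r.
- by move=> w _; rewrite lee_fin mixture_ge0.
- by apply/measurable_EFinP; exact: mixture_measurable int _.
Qed.

Lemma context_score_measurable kappa m t :
  measurable_fun setT (context_score kappa m t).
Proof.
by apply: measurable_funM => //; exact: context_count_measurable int m _ t.
Qed.

Lemma integral_context_score kappa m t :
  (\int[P]_w (context_score kappa m t w)%:E =
  (expR (kappa * ln t.+1%:R) * (1 - p m * (1 - expR (- 1))) ^+ (t - t./2))%:E)%E.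
Proof.
under eq_integral do rewrite EFinM.
rewrite ge0_integralZl_EFin ?expR_ge0//.
- by rewrite (integral_context_count int)//; lia.
- by move=> w _; rewrite lee_fin prodr_ge0// => s _; exact: expR_ge0.
- by apply/measurable_EFinP; exact: context_count_measurable int m _ t.
Qed.

Lemma integral_score kappa t : (0 < t./2)%N ->
  (\int[P]_w (score kappa t w)%:E =
   (\sum_(t./2 <= j < t.+1) (j%:R ^+ 3)^-1 + \sum_(m < M)
     expR (kappa * ln t.+1%:R) * (1 - p m * (1 - expR (- 1))) ^+ (t - t./2))%:E)%E.
Proof.
move=> h0; under eq_integral do rewrite /score EFinD -!sumEFin.
have mm j : measurable_fun setT (fun w => (mixture_score j w)%:E).
  by apply/measurable_EFinP; exact: mixture_score_measurable.
have mc m : measurable_fun setT (fun w => (context_score kappa m t w)%:E).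
  by apply/measurable_EFinP; exact: context_score_measurable.
have m0 j w : (0 <= (mixture_score j w)%:E)%E by rewrite lee_fin mixture_score_ge0.
have c0 m w : (0 <= (context_score kappa m t w)%:E)%E by rewrite lee_fin context_score_ge0.
rewrite ge0_integralD//.
- rewrite !ge0_integral_sum// EFinD -!sumEFin; congr (_ + _)%E.
    rewrite !big_nat; apply: eq_bigr => j /andP[hj _].
    by rewrite integral_mixture_score// (leq_trans h0).
  by apply: eq_bigr => m _; exact: integral_context_score.
- by move=> w _; exact: sume_ge0.
- exact: emeasurable_sum.
- by move=> w _; exact: sume_ge0.
- exact: emeasurable_sum.
Qed.

Lemma score_measurable kappa t : measurable_fun setT (score kappa t).
Proof.
apply: measurable_funD; apply: measurable_sum => i.
  exact: mixture_score_measurable.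
exact: context_score_measurable.
Qed.

Lemma score_ge0 kappa t w : 0 <= score kappa t w.
Proof.
rewrite addr_ge0// sumr_ge0// => i _; first exact: mixture_score_ge0.
exact: context_score_ge0.
Qed.

(** Pathwise the gap is at most [D] times the score. In the mean of the score, 27 comes from the
    mixtures in the window and [M] from one tail per context. *)
Lemma near_gap_round (D : R) : 0 <= D ->
  (forall m x, x \in A m -> arm_gap theta xstar m x <= D) ->
  \forall t \near \oo,
  (\int[P]_w (gap_round t.+1 w)%:E <= (D * (27 + M%:R) / t%:R ^+ 2)%:E)%E.
Proof.
move=> D0 DP; have [kappa kP] := near_suboptimal_score.
have tails : \forall t \near \oo, forall m : 'I_M, expR (kappa * ln t.+1%:R) *
    (1 - p m * (1 - expR (- 1))) ^+ (t - t./2) <= (t%:R ^+ 2)^-1.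
  apply: filter_forall => m; apply: near_context_tail.
  by rewrite p_gt0 (context_proba_le1 p_gt0 p_sum).
near=> t.
have t3 : (3 <= t)%N by near: t; exact: nbhs_infty_ge.
have sub w : X t.+1 w != xstar (c t.+1 w) -> 1 <= score kappa t w.
  by move: w; near: t.
have tail m : expR (kappa * ln t.+1%:R) *
    (1 - p m * (1 - expR (- 1))) ^+ (t - t./2) <= (t%:R ^+ 2)^-1.
  by move: m; near: t.
have h0 : (0 < t./2)%N by lia.
apply: (@le_trans _ _ (\int[P]_w (D%:E * (score kappa t w)%:E)))%E.
  apply: ge0_le_integral => //.
  - by move=> w _; rewrite lee_fin (round_gap_ge0 opt int).
  - by apply/measurable_EFinP; exact: round_gap_measurable int _ _.
  - by apply: measurable_funeM; apply/measurable_EFinP; exact: score_measurable.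
  - move=> w _; rewrite -EFinM lee_fin /round_gap.
    have [->|/sub s1] := eqVneq (X t.+1 w) (xstar (c t.+1 w)).
      by rewrite /arm_gap subrr mulr_ge0// score_ge0.
    apply: (@le_trans _ _ D); last by rewrite ler_peMr.
    by apply: DP; exact: (action_available int).
rewrite ge0_integralZl_EFin//; last 2 first.
- by move=> w _; rewrite lee_fin score_ge0.
- by apply/measurable_EFinP; exact: score_measurable.
rewrite integral_score// -EFinM lee_fin -mulrA ler_wpM2l// mulrDl lerD//.
  exact: half_window_sum.
apply: (@le_trans _ _ (\sum_(m < M) (t%:R ^+ 2)^-1)).
  by apply: ler_sum => m _; exact: tail.
by rewrite sumr_const card_ord mulr_natl.
Unshelve. all: by end_near. Qed.

End BoundedRegret.

(* beta depends only on t and d, with a constant in O(d log t) that is also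
   uniform in d; in particular it uses neither theta nor p. *)
Theorem theorem3p9 (R : realType) :
  exists2 C : R, 0 < C &
  forall d : nat, exists2 beta : nat -> R,
    (forall t : nat, (1 < t)%N -> 0 <= beta t <= C * d%:R * ln t%:R) &
  forall (M K : nat) (A : 'I_M -> {fset 'cV[R]_d}) (theta : 'cV[R]_d)
    (p : 'I_M -> R) (xstar : 'I_M -> 'cV[R]_d)
    (disp : measure_display) (T : measurableType disp) (P : probability T R)
    (c : nat -> T -> 'I_M) (X : nat -> T -> 'cV[R]_d)
    (eta : nat -> {RV P >-> R}),
    action_sets K A ->
    (forall m, 0 < p m) -> \sum_m p m = 1 ->
    unique_optimal A theta xstar ->
    spanning [seq xstar m | m : 'I_M] ->
    interaction A p c X eta ->
    optimistic A theta c X eta beta ->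
    (limn_esup (regret theta c X eta xstar) < +oo)%E.
Proof.
exists 16 => // d; exists (fun t => 16 * d%:R * ln t%:R).
  by move=> t t1; rewrite lexx andbT !mulr_ge0// ln_ge0// ler1n ltnW.
move=> M K A theta p xstar disp T P c X eta sets p0 p1 opt span int pol.
have [D D0 DP] := arm_gap_ubound A theta xstar.
pose r t : R := fine (\int[P]_w (round_gap theta xstar c X t w)%:E)%E.
have rE t : (0 < t)%N -> (\int[P]_w (round_gap theta xstar c X t w)%:E = (r t)%:E)%E.
  move=> t0; rewrite fineK//; apply: integrable_fin_num => //.
  exact: round_gap_integrable opt int _ t0.
have C0 : 0 <= D * (27 + M%:R) by rewrite mulr_ge0// addr_ge0.
have [t0 t00 rK] : exists2 t0, (0 < t0)%N &
    forall t, (t0 <= t)%N -> r t.+1 <= D * (27 + M%:R) / t%:R ^+ 2.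
  (* The confidence bound was obtained for [d > 0]; in dimension 0 all gaps vanish. *)
  have [d0|d0] := posnP d.
    exists 1%N => // t _; rewrite /r.
    under eq_integral => w _.
      rewrite (_ : round_gap theta xstar c X t.+1 w = 0).
        over.
      rewrite /round_gap /arm_gap !dotvE !big1 ?subrr// => i _;
        by have := ltn_ord i; rewrite [X in (_ < X)%N]d0.
    by rewrite integral0 divr_ge0.
  have [N _ NP] := near_gap_round sets p0 p1 opt span int pol d0 D0 DP.
  exists N.+1 => // t Nt; rewrite -lee_fin -rE//; apply: NP => /=.
  exact: ltnW.
(* The crude bound for the finitely many rounds up to [t0]. *)
have rD t : (0 < t)%N -> r t <= D.
  move=> t1; rewrite -lee_fin -rE//.
  rewrite (_ : D%:E = \int[P]_w cst D%:E w)%E; last first.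
    rewrite integral_cst// -[LHS]mule1; congr (_ * _)%E; apply/esym.
    exact: probability_setT.
  apply: ge0_le_integral => //.
  - by move=> w _; rewrite lee_fin (round_gap_ge0 opt int).
  - by apply/measurable_EFinP; exact: round_gap_measurable int _ t1.
  - by move=> w _; rewrite lee_fin; apply: DP; exact: action_available int _ w t1.
(* This bound does not depend on [n], so it passes to the upper limit. *)
apply: (@le_lt_trans _ _ (D * t0%:R + 2 * (D * (27 + M%:R)))%:E); last exact: ltry.
apply: limn_esup_le_bound => n; rewrite (regretE opt int) big_nat.
under eq_bigr => t /andP[t1 _] do rewrite rE//.
rewrite -big_nat sumEFin lee_fin.
exact: sum_le_inv_sqr.
Qed.
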